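(* Let $$x_0 = \frac{2}{3} -\frac{\sqrt[3]{44+12 \sqrt{69}}}{6} + \frac{10}{ 3 \sqrt[3]{44+12\sqrt{69}}},$$ and let $T_0$ be the triangle with vertices $(0,0)$, $(1,0)$ and $(x_0,1)$. Let $T$ be a triangle in the plane. (1) $T$ is weakly invariant if and only if $T$ is similar to $T_0$. Furthermore, in this case $T$ is invariant, but not strongly invariant. (2) Suppose that $f_{T,R}(T)$ is not similar to $T_0$ for any extremal rectangle $R$ of $T$. Let $\{T_k\}$, $k=1,2,3,\ldots$, be any sequence of triangles with $T_1=T$ such that for every $k\ge 1$ there is an extremal rectangle $R_k$ of $T_k$ with $$T_{k+1}=\frac{1}{\operatorname{diam} f_{T_k,R_k}(T_k)}\, f_{T_k,R_k}(T_k).$$ Then the elements of $\{T_k\}$ are mutually non-congruent, and, in the topology defined by Hausdorff distance up to congruence, $\{T_k\}$ converges to $T_0$.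
   Context: Triangles are nondegenerate and regarded as plane convex bodies (compact convex sets in $\mathbb{R}^2$ with nonempty interior). Let $K$ be a plane convex body. A rectangle $R$ (of arbitrary orientation) is circumscribed about $K$ if $K\subseteq R$ and every side of $R$ contains a point of $K$; let $a(R)\le b(R)$ denote the side lengths of $R$. $R$ is an extremal rectangle of $K$ if $R$ is circumscribed about $K$ and $\frac{a(R)}{b(R)}=\inf\{\frac{a(R')}{b(R')}: R' \text{ is a rectangle circumscribed about } K\}$. For an extremal rectangle $R$ of $K$, let $L$ be the line through the origin $o$ parallel to the sides of $R$ of length $a(R)$; $f_{K,R}$ denotes the orthogonal affinity with axis $L$ and ratio $\frac{a(R)}{b(R)}$, i.e. the linear map fixing $L$ pointwise and multiplying vectors orthogonal to $L$ by $\frac{a(R)}{b(R)}$ (if $R$ is a square, $f_{K,R}$ is the identity). $K$ is weakly invariant if $f_{K,R}(K)$ is similar to $K$ for some extremal rectangle $R$ of $K$; invariant if $f_{K,R}(K)$ is similar to $K$ for every extremal rectangle $R$ of $K$; strongly invariant if every rectangle circumscribed about $K$ is a square. Similarities and congruences may be orientation-reversing. $\operatorname{diam}$ denotes the diameter. Convergence of $T_k$ to $S$ in the topology defined by Hausdorff distance up to congruence means that there are congruences $\varphi_k$ of the plane such that $\varphi_k(T_k)\to S$ in the Hausdorff metric.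
   Formalization: In (2) the limit T_0 is replaced by T_0 scaled to unit diameter, (1/diam T_0) T_0; as written the convergence is impossible, since diam T_k = 1 for k ≥ 2 while diam T_0 = sqrt(1+(1-x_0)^2) > 1. *)

(* Defs.v *)
From HB Require Import structures.
From mathcomp Require Import all_boot all_order all_algebra.
From mathcomp Require Import all_classical all_reals all_analysis.

Set Implicit Arguments.
Unset Strict Implicit.
Unset Printing Implicit Defensive.

Import Order.TTheory GRing.Theory Num.Theory.
Import numFieldNormedType.Exports.

Local Open Scope classical_set_scope.
Local Open Scope ring_scope.

(* The library norm on 'rV[R]_2 is the sup norm, so the Euclidean structure of
   the plane is set up explicitly. *)

Definition pt (R : realType) (x y : R) : 'rV[R]_2 :=
  \row_(i < 2) (if i == 0 then x else y).

Definition dot (R : realType) (u v : 'rV[R]_2) : R := \sum_i u 0 i * v 0 i.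

Definition eucl_dist (R : realType) (u v : 'rV[R]_2) : R :=
  Num.sqrt (dot (u - v) (u - v)).

Definition perp (R : realType) (v : 'rV[R]_2) : 'rV[R]_2 :=
  pt (- v 0 1) (v 0 0).

Definition similarity (R : realType) (phi : 'rV[R]_2 -> 'rV[R]_2) : Prop :=
  exists2 c : R, 0 < c &
    forall x y, eucl_dist (phi x) (phi y) = c * eucl_dist x y.

Definition congruence (R : realType) (phi : 'rV[R]_2 -> 'rV[R]_2) : Prop :=
  forall x y, eucl_dist (phi x) (phi y) = eucl_dist x y.

Definition similar_sets (R : realType) (A B : set 'rV[R]_2) : Prop :=
  exists2 phi, similarity phi & phi @` A = B.

Definition congruent_sets (R : realType) (A B : set 'rV[R]_2) : Prop :=
  exists2 phi, congruence phi & phi @` A = B.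

Definition diam (R : realType) (A : set 'rV[R]_2) : R :=
  sup [set eucl_dist x y | x in A & y in A].

(* The triangle [T0] below has diameter > 1, so unit-diameter triangles can
   approach it only in the form [normalize (T0 R)]. *)
Definition normalize (R : realType) (A : set 'rV[R]_2) : set 'rV[R]_2 :=
  [set (diam A)^-1 *: x | x in A].

Definition dist_to (R : realType) (A : set 'rV[R]_2) (x : 'rV[R]_2) : R :=
  inf [set eucl_dist x y | y in A].

(* For nonempty bounded sets this is the usual Hausdorff distance; [sup] and
   [inf] have junk values otherwise. *)
Definition hausdorff (R : realType) (A B : set 'rV[R]_2) : R :=
  Num.max (sup [set dist_to B x | x in A]) (sup [set dist_to A y | y in B]).

Definition conv3 (R : realType) (p q r : 'rV[R]_2) : set 'rV[R]_2 :=
  [set x | exists a b c : R, [/\ 0 <= a, 0 <= b, 0 <= c, a + b + c = 1 &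
                               x = a *: p + b *: q + c *: r]].

Definition triangle (R : realType) (A : set 'rV[R]_2) : Prop :=
  exists p q r : 'rV[R]_2,
    row_free (col_mx (q - p) (r - p)) /\ A = conv3 p q r.

(* A rectangle is given by a corner, the unit direction of one pair of sides,
   the length [rlen] of the sides in that direction and the length [rwid] of
   the sides in the perpendicular direction. Every rectangle arises in several
   ways, but [rratio], [raff] and the predicates below depend only on the
   underlying set [rbody]. *)
Record rectangle (R : realType) := Rectangle {
  rcorner : 'rV[R]_2;
  rdir : 'rV[R]_2;
  rlen : R;
  rwid : R;
  rdir_unit : dot rdir rdir = 1;
  rlen_gt0 : 0 < rlen;
  rwid_gt0 : 0 < rwid }.

Definition rpoint (R : realType) (Q : rectangle R) (x y : R) : 'rV[R]_2 :=
  rcorner Q + x *: rdir Q + y *: perp (rdir Q).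

Definition rbody (R : realType) (Q : rectangle R) : set 'rV[R]_2 :=
  [set rpoint Q x y | x in `[0, rlen Q] & y in `[0, rwid Q]].

Definition rsides (R : realType) (Q : rectangle R) : set (set 'rV[R]_2) :=
  [set [set rpoint Q x 0 | x in `[0, rlen Q]];
       [set rpoint Q x (rwid Q) | x in `[0, rlen Q]];
       [set rpoint Q 0 y | y in `[0, rwid Q]];
       [set rpoint Q (rlen Q) y | y in `[0, rwid Q]]].

Definition circumscribed (R : realType) (K : set 'rV[R]_2)
    (Q : rectangle R) : Prop :=
  K `<=` rbody Q /\ forall s, rsides Q s -> K `&` s !=set0.

Definition rratio (R : realType) (Q : rectangle R) : R :=
  Num.min (rlen Q) (rwid Q) / Num.max (rlen Q) (rwid Q).

Definition extremal (R : realType) (K : set 'rV[R]_2)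
    (Q : rectangle R) : Prop :=
  circumscribed K Q /\ rratio Q = inf [set rratio Q' | Q' in circumscribed K].

(* For a unit vector [v], this fixes the line spanned by [v] pointwise and
   multiplies the vectors orthogonal to [v] by [c]. *)
Definition orth_affinity (R : realType) (v : 'rV[R]_2) (c : R)
    (x : 'rV[R]_2) : 'rV[R]_2 :=
  dot x v *: v + c *: (x - dot x v *: v).

Definition short_dir (R : realType) (Q : rectangle R) : 'rV[R]_2 :=
  if rlen Q <= rwid Q then rdir Q else perp (rdir Q).

Definition raff (R : realType) (Q : rectangle R) : 'rV[R]_2 -> 'rV[R]_2 :=
  orth_affinity (short_dir Q) (rratio Q).

Definition weakly_invariant_body (R : realType) (K : set 'rV[R]_2) : Prop :=
  exists2 Q, extremal K Q & similar_sets (raff Q @` K) K.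

Definition invariant_body (R : realType) (K : set 'rV[R]_2) : Prop :=
  forall Q, extremal K Q -> similar_sets (raff Q @` K) K.

Definition strongly_invariant_body (R : realType) (K : set 'rV[R]_2) : Prop :=
  forall Q, circumscribed K Q -> rlen Q = rwid Q.

Definition cbrt (R : realType) (x : R) : R := x `^ 3^-1.

Definition x0 (R : realType) : R :=
  2 / 3 - cbrt (44 + 12 * Num.sqrt 69) / 6
  + 10 / (3 * cbrt (44 + 12 * Num.sqrt 69)).

Definition T0 (R : realType) : set 'rV[R]_2 :=
  conv3 (pt 0 0) (pt 1 0) (pt (x0 R) 1).
Arguments T0 R : clear implicits.

Definition converges_upto_congruence (R : realType)
    (S : nat -> set 'rV[R]_2) (A : set 'rV[R]_2) : Prop :=
  exists2 phi : nat -> 'rV[R]_2 -> 'rV[R]_2, (forall k, congruence (phi k)) &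
    hausdorff (phi k @` S k) A @[k --> \oo] --> (0 : R).

(* Main.v *)
(* Let [a] be the squared length of a longest side and [d] twice the area of a
   triangle. A circumscribed rectangle with sides [m <= M] has area at least [d]
   and [M ^ 2 <= a], so its ratio [m / M = m * M / M ^ 2] is at least [d / a],
   with equality exactly when a long side of it lies along a longest side of the
   triangle. The affinity of an extremal rectangle therefore makes that side and
   its altitude equal, and the image is similar to the triangle with vertices
   [(0,0)], [(1,0)], [(t,1)], where [0 <= t <= 1/2] locates the foot of the
   altitude. On such triangles the construction acts by
   [t |-> (1 - t) / (1 + (1 - t) ^ 2)], which is injective and contracts
   [[0, 1/2]] by a factor [1/2]; its fixed points are the roots of
   [t^3 - 2 t^2 + 3 t - 1], whose only real root is [x0] by Cardano's formula. *)

Require Import Defs.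
From mathcomp Require Import all_boot all_order all_algebra.
From mathcomp Require Import all_classical all_reals all_analysis.
From mathcomp Require Import ring lra.
Import Order.TTheory GRing.Theory Num.Theory.
Import numFieldNormedType.Exports.
Local Open Scope classical_set_scope.
Local Open Scope ring_scope.

(** * Triangles described by their squared side lengths *)

Definition sqd {R : realType} (u v : 'rV[R]_2) : R := dot (u - v) (u - v).

(* Heron: sixteen times the squared area of a triangle with squared side lengths
   [a], [b], [c]. *)
Definition gram {R : realType} (a b c : R) : R :=
  4 * a * b - (a + b - c) ^+ 2.

(** Twice the signed area of the triangle, positive for counterclockwise vertices. *)
Definition cross {R : realType} (p q r : 'rV[R]_2) : R :=
  (q 0 0 - p 0 0) * (r 0 1 - p 0 1) - (r 0 0 - p 0 0) * (q 0 1 - p 0 1).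

(** The vertices may be labelled in any order, so one set admits several triples; [shape] selects
    one by ordering them. *)
Definition sides {R : realType} (A : set 'rV[R]_2) (a b c : R) : Prop :=
  exists p q r, [/\ A = conv3 p q r, sqd p q = a, sqd p r = b & sqd q r = c].

(* For a triangle [p q r] with these squared sides, the foot of the altitude from
   [r] divides the longest side [p q] at the fraction [(a + b - c) / (2 * a)]
   from [p], which is at most [1 / 2] since [b <= c]. *)
Definition shape {R : realType} (A : set 'rV[R]_2) (a b c : R) : Prop :=
  [/\ sides A a b c, 0 < gram a b c, b <= c & c <= a].

Lemma row2P {R : realType} (u v : 'rV[R]_2) :
  u 0 0 = v 0 0 -> u 0 1 = v 0 1 -> u = v.
Proof.
move=> h0 h1; apply/rowP => i.
case: (eqVneq i 0) => [->//|hi].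
by have -> : i = 1 by apply/val_inj; case: i hi => [[|[|]]].
Qed.

Lemma dotE {R : realType} (u v : 'rV[R]_2) :
  dot u v = u 0 0 * v 0 0 + u 0 1 * v 0 1.
Proof.
rewrite /dot !big_ord_recl big_ord0 addr0.
by have -> : lift ord0 ord0 = 1 :> 'I_2 by apply/val_inj.
Qed.

Lemma pt0E {R : realType} (x y : R) : pt x y 0 0 = x.
Proof. by rewrite mxE. Qed.

Lemma pt1E {R : realType} (x y : R) : pt x y 0 1 = y.
Proof. by rewrite mxE. Qed.

Lemma perp0E {R : realType} (v : 'rV[R]_2) : perp v 0 0 = - v 0 1.
Proof. exact: pt0E. Qed.

Lemma perp1E {R : realType} (v : 'rV[R]_2) : perp v 0 1 = v 0 0.
Proof. exact: pt1E. Qed.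

Lemma addE {R : realType} (u v : 'rV[R]_2) i : (u + v) 0 i = u 0 i + v 0 i.
Proof. by rewrite mxE. Qed.

Lemma oppE {R : realType} (u : 'rV[R]_2) i : (- u) 0 i = - u 0 i.
Proof. by rewrite mxE. Qed.

Lemma scaleE {R : realType} (a : R) (u : 'rV[R]_2) i : (a *: u) 0 i = a * u 0 i.
Proof. by rewrite mxE. Qed.

Definition coordE := (@addE, @oppE, @scaleE, @pt0E, @pt1E, @perp0E, @perp1E).

Lemma sqdE {R : realType} (u v : 'rV[R]_2) :
  sqd u v = (u 0 0 - v 0 0) ^+ 2 + (u 0 1 - v 0 1) ^+ 2.
Proof. by rewrite /sqd dotE !coordE !expr2. Qed.

Lemma sqd_ge0 {R : realType} (u v : 'rV[R]_2) : 0 <= sqd u v.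
Proof. by rewrite sqdE addr_ge0 ?sqr_ge0. Qed.

Lemma sqdxx {R : realType} (u : 'rV[R]_2) : sqd u u = 0.
Proof. by rewrite sqdE !subrr expr0n addr0. Qed.

Lemma sqdC {R : realType} (u v : 'rV[R]_2) : sqd u v = sqd v u.
Proof. by rewrite !sqdE; ring. Qed.

Lemma sqd_eq0 {R : realType} (u v : 'rV[R]_2) : sqd u v = 0 -> u = v.
Proof.
rewrite sqdE => /eqP; rewrite paddr_eq0 ?sqr_ge0// !sqrf_eq0 !subr_eq0.
by case/andP => /eqP h0 /eqP h1; apply: row2P.
Qed.

Lemma eucl_distE {R : realType} (u v : 'rV[R]_2) :
  eucl_dist u v = Num.sqrt (sqd u v).
Proof. by []. Qed.

Lemma gram_sqd {R : realType} (p q r : 'rV[R]_2) :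
  gram (sqd p q) (sqd p r) (sqd q r) = 4 * cross p q r ^+ 2.
Proof. by rewrite /gram /cross !sqdE; ring. Qed.

Lemma gram_gt0P {R : realType} (p q r : 'rV[R]_2) :
  (0 < gram (sqd p q) (sqd p r) (sqd q r)) = (cross p q r != 0).
Proof. by rewrite gram_sqd pmulr_rgt0// lt0r sqrf_eq0 sqr_ge0 andbT. Qed.

Lemma conv3_swap12 {R : realType} (p q r : 'rV[R]_2) :
  conv3 p q r = conv3 q p r.
Proof.
by apply/seteqP; split => x [a [b [c [? ? ? ? ->]]]]; exists b, a, c; split=> //;
  rewrite ?(addrC b) ?(addrC (b *: _)).
Qed.

Lemma conv3_swap23 {R : realType} (p q r : 'rV[R]_2) :
  conv3 p q r = conv3 p r q.
Proof.
by apply/seteqP; split => x [a [b [c [? ? ? ? ->]]]]; exists a, c, b; split=> //;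
  rewrite addrAC.
Qed.

Lemma conv3_1 {R : realType} (p q r : 'rV[R]_2) : conv3 p q r p.
Proof.
by exists 1, 0, 0; split=> //; rewrite ?scale1r ?scale0r ?addr0.
Qed.

Lemma conv3_2 {R : realType} (p q r : 'rV[R]_2) : conv3 p q r q.
Proof. by rewrite conv3_swap12; exact: conv3_1. Qed.

Lemma conv3_3 {R : realType} (p q r : 'rV[R]_2) : conv3 p q r r.
Proof. by rewrite conv3_swap23; exact: conv3_2. Qed.

Lemma conv3_image {R : realType} (f : 'rV[R]_2 -> 'rV[R]_2)
    (p q r p' q' r' : 'rV[R]_2) :
  (forall a b c, a + b + c = 1 ->
    f (a *: p + b *: q + c *: r) = a *: p' + b *: q' + c *: r') ->
  f @` conv3 p q r = conv3 p' q' r'.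
Proof.
move=> h; apply/seteqP; split => x.
  by move=> [_ [a [b [c [? ? ? habc ->]]]] <-]; rewrite h//; exists a, b, c.
move=> [a [b [c [? ? ? habc ->]]]].
by exists (a *: p + b *: q + c *: r); [exists a, b, c|rewrite h].
Qed.

Lemma sides_swap12 {R : realType} (A : set 'rV[R]_2) (a b c : R) :
  sides A a b c -> sides A a c b.
Proof.
move=> [p [q [r [-> <- <- <-]]]]; exists q, p, r.
by split; rewrite 1?sqdC // conv3_swap12.
Qed.

Lemma sides_swap23 {R : realType} (A : set 'rV[R]_2) (a b c : R) :
  sides A a b c -> sides A b a c.
Proof.
move=> [p [q [r [-> <- <- <-]]]]; exists p, r, q.
by split; rewrite // 1?sqdC // conv3_swap23.
Qed.

Lemma gram_swap12 {R : realType} (a b c : R) : gram a b c = gram a c b.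
Proof. by rewrite /gram; ring. Qed.

Lemma gram_swap23 {R : realType} (a b c : R) : gram a b c = gram b a c.
Proof. by rewrite /gram; ring. Qed.

Lemma gramZ {R : realType} (k a b c : R) :
  gram (k * a) (k * b) (k * c) = k ^+ 2 * gram a b c.
Proof. by rewrite /gram; ring. Qed.

Lemma sides_ge0 {R : realType} (A : set 'rV[R]_2) (a b c : R) :
  sides A a b c -> [/\ 0 <= a, 0 <= b & 0 <= c].
Proof. by move=> [p [q [r [_ <- <- <-]]]]; rewrite !sqd_ge0. Qed.

Lemma gram_gt0 {R : realType} (a b c : R) :
  0 <= b -> 0 < gram a b c -> 0 < a.
Proof.
rewrite /gram => b0 h; rewrite ltNge; apply/negP => a0.
by have := sqr_ge0 (a + b - c); nra.
Qed.

Lemma sides_gt0 {R : realType} (A : set 'rV[R]_2) (a b c : R) :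
  sides A a b c -> 0 < gram a b c -> [/\ 0 < a, 0 < b & 0 < c].
Proof.
move=> /sides_ge0[a0 b0 c0] g; split; first exact: gram_gt0 g.
  by move: g; rewrite gram_swap23; exact: gram_gt0.
by move: g; rewrite gram_swap12 gram_swap23; exact: gram_gt0.
Qed.

Lemma sides_max_shape {R : realType} (A : set 'rV[R]_2) (a b c : R) :
  sides A a b c -> 0 < gram a b c -> b <= a -> c <= a ->
  shape A a b c \/ shape A a c b.
Proof.
move=> h g hb hc; have [bc|/ltW cb] := leP b c; [by left|right].
by split=> //; [exact: sides_swap12|rewrite gram_swap12].
Qed.

Lemma sides_shape {R : realType} (A : set 'rV[R]_2) (a b c : R) :
  sides A a b c -> 0 < gram a b c -> exists a' b' c', shape A a' b' c'.
Proof.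
wlog cb : b c / c <= b.
  move=> w h g; have [cb|/ltW bc] := leP c b; first exact: w h g.
  by apply: (w c b) => //; [exact: sides_swap12|rewrite gram_swap12].
move=> h g; have [ba|/ltW ab] := leP b a.
  by case: (sides_max_shape _ _ _ _ h g ba (le_trans cb ba)) => ?; do 3 eexists; eassumption.
move/sides_swap23: h; move: g; rewrite gram_swap23 => g h.
by case: (sides_max_shape _ _ _ _ h g ab cb) => ?; do 3 eexists; eassumption.
Qed.

(** * Similarities and side lengths *)

(** Leibniz' formula for the distance to a barycentre. It involves squared distances only, so it
    transfers along any map that scales distances. *)
Lemma leibniz {R : realType} (w p q r : 'rV[R]_2) (a b c : R) :
  a + b + c = 1 ->
  sqd w (a *: p + b *: q + c *: r) =
    a * sqd w p + b * sqd w q + c * sqd w r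
    - a * b * sqd p q - a * c * sqd p r - b * c * sqd q r.
Proof.
move=> h; have -> : a = 1 - b - c by lra.
by rewrite !sqdE !coordE; ring.
Qed.

(* Both sides of [leibniz] scale by [k], so the distance of the image of a
   barycentre to the barycentre of the images is zero. *)
Lemma scaling_conv3 {R : realType} (f : 'rV[R]_2 -> 'rV[R]_2) (k : R)
    (p q r : 'rV[R]_2) :
  (forall x y, sqd (f x) (f y) = k * sqd x y) ->
  f @` conv3 p q r = conv3 (f p) (f q) (f r).
Proof.
move=> hf; apply: conv3_image => a b c habc; apply: sqd_eq0.
set z := _ + _ + c *: r; rewrite leibniz// !hf.
have := leibniz z p q r a b c habc; rewrite -/z sqdxx => h.
transitivity (k * 0); last by rewrite mulr0.
by rewrite h; ring.
Qed.

Lemma scaling_sides {R : realType} (f : 'rV[R]_2 -> 'rV[R]_2) (k : R)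
    (A : set 'rV[R]_2) (a b c : R) :
  (forall x y, sqd (f x) (f y) = k * sqd x y) ->
  sides A a b c -> sides (f @` A) (k * a) (k * b) (k * c).
Proof.
move=> hf [p [q [r [-> <- <- <-]]]]; exists (f p), (f q), (f r).
by rewrite !hf; split=> //; exact: (scaling_conv3 _ k).
Qed.

Lemma eucl_dist_scaling {R : realType} (x y x' y' : 'rV[R]_2) (c : R) :
  0 < c -> eucl_dist x' y' = c * eucl_dist x y <-> sqd x' y' = c ^+ 2 * sqd x y.
Proof.
move=> c0; rewrite !eucl_distE; split => [h|->].
  by rewrite -(sqr_sqrtr (sqd_ge0 x' y')) h exprMn sqr_sqrtr// sqd_ge0.
by rewrite sqrtrM ?sqr_ge0// sqrtr_sqr gtr0_norm.
Qed.

Lemma congruenceP {R : realType} (f : 'rV[R]_2 -> 'rV[R]_2) :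
  congruence f <-> forall x y, sqd (f x) (f y) = sqd x y.
Proof.
split=> h x y.
  have /(eucl_dist_scaling _ _ _ _ _ ltr01) : eucl_dist (f x) (f y) = 1 * eucl_dist x y.
    by rewrite mul1r.
  by rewrite expr1n mul1r.
by rewrite !eucl_distE h.
Qed.

Lemma similar_sides {R : realType} (A B : set 'rV[R]_2) (a b c : R) :
  similar_sets A B -> sides A a b c ->
  exists2 k, 0 < k & sides B (k * a) (k * b) (k * c).
Proof.
move=> [f [c0 c00 hf] <-] h; exists (c0 ^+ 2); first exact: exprn_gt0.
by apply: scaling_sides => // x y; apply/eucl_dist_scaling.
Qed.

Lemma congruent_sides {R : realType} (A B : set 'rV[R]_2) (a b c : R) :
  congruent_sets A B -> sides A a b c -> sides B a b c.
Proof.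
move=> [f /congruenceP hf <-] h.
by rewrite -(mul1r a) -(mul1r b) -(mul1r c); apply: scaling_sides => // x y;
  rewrite mul1r.
Qed.

(** Polarization: the last bracket is twice the inner product of [q - p] and [r - p]. *)
Lemma sqd_comb {R : realType} (x y p q r : 'rV[R]_2) (s t : R) :
  x - y = s *: (q - p) + t *: (r - p) ->
  sqd x y = s ^+ 2 * sqd p q + t ^+ 2 * sqd p r
    + s * t * (sqd p q + sqd p r - sqd q r).
Proof. by rewrite {1}/sqd => ->; rewrite !sqdE dotE !coordE; ring. Qed.

(** The side-side-side criterion: the affine map matching the vertices scales all squared distances
    by [k], since by [sqd_comb] these depend only on the sides and on affine coordinates. *)
Lemma scaling_exists {R : realType} (k : R) (p q r p' q' r' : 'rV[R]_2) :
  cross p q r != 0 -> sqd p' q' = k * sqd p q -> sqd p' r' = k * sqd p r ->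
  sqd q' r' = k * sqd q r ->
  exists f, [/\ forall x y, sqd (f x) (f y) = k * sqd x y,
    f p = p', f q = q' & f r = r'].
Proof.
move=> D0 hpq hpr hqr.
(* Cramer's rule: the coordinates of [z] with respect to the origin [p] and the basis [q - p],
   [r - p]. *)
pose al z := cross p z r / cross p q r; pose be z := cross p q z / cross p q r.
exists (fun z => p' + al z *: (q' - p') + be z *: (r' - p')); split.
- move=> x y.
  have /sqd_comb -> : (p' + al x *: (q' - p') + be x *: (r' - p')) -
      (p' + al y *: (q' - p') + be y *: (r' - p')) =
      (al x - al y) *: (q' - p') + (be x - be y) *: (r' - p').
    by apply: row2P; rewrite !coordE; ring.
  have /sqd_comb -> : x - y = (al x - al y) *: (q - p) + (be x - be y) *: (r - p).
    by apply: row2P; rewrite !coordE /al /be; move: D0; rewrite /cross => D0; field.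
  by rewrite hpq hpr hqr; ring.
- have -> : al p = 0 by rewrite /al /cross; ring.
  have -> : be p = 0 by rewrite /be /cross; ring.
  by rewrite !scale0r !addr0.
- have -> : al q = 1 by rewrite /al divff.
  have -> : be q = 0 by rewrite /be /cross; ring.
  by rewrite scale0r scale1r addr0 addrC subrK.
- have -> : al r = 0 by rewrite /al /cross; ring.
  have -> : be r = 1 by rewrite /be divff.
  by rewrite scale0r scale1r addr0 addrC subrK.
Qed.

Lemma sides_scaling {R : realType} (A B : set 'rV[R]_2) (k a b c : R) :
  sides A a b c -> 0 < gram a b c -> sides B (k * a) (k * b) (k * c) ->
  exists2 f, (forall x y, sqd (f x) (f y) = k * sqd x y) & f @` A = B.
Proof.
move=> [p [q [r [-> <- <- <-]]]]; rewrite gram_gt0P => D0.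
move=> [p' [q' [r' [-> hpq hpr hqr]]]].
have [f [hf hp hq hr]] := scaling_exists _ _ _ _ _ _ _ D0 hpq hpr hqr.
by exists f => //; rewrite (scaling_conv3 _ k)// hp hq hr.
Qed.

Lemma sides_similar {R : realType} (A B : set 'rV[R]_2) (k a b c : R) :
  0 < k -> sides A a b c -> 0 < gram a b c ->
  sides B (k * a) (k * b) (k * c) -> similar_sets A B.
Proof.
move=> k0 hA g hB; have [f hf fAB] := sides_scaling _ _ _ _ _ _ hA g hB.
exists f => //; exists (Num.sqrt k); first by rewrite sqrtr_gt0.
by move=> x y; apply/eucl_dist_scaling; rewrite ?sqrtr_gt0// sqr_sqrtr ?ltW.
Qed.

(** * Vertices *)

(** Extreme points in midpoint form. The notion refers to the set alone, which allows the vertices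
    to be recovered from the set. *)
Definition extreme {R : realType} (A : set 'rV[R]_2) (x : 'rV[R]_2) : Prop :=
  A x /\ forall y z, A y -> A z -> x + x = y + z -> y = z.

Lemma cross_neq0 {R : realType} (p q r : 'rV[R]_2) :
  cross p q r != 0 -> [/\ p <> q, p <> r & q <> r].
Proof.
by move=> D0; split=> e; move: D0; rewrite e /cross => /eqP; apply; ring.
Qed.

Lemma cross_free {R : realType} (p q r : 'rV[R]_2) (s t : R) :
  cross p q r != 0 -> s *: (q - p) + t *: (r - p) = 0 -> s = 0 /\ t = 0.
Proof.
move=> D0 /rowP h; have := h 1; have := h 0; rewrite !coordE !mxE => h0 h1.
split; apply: (mulIf D0); rewrite mul0r /cross.
  transitivity ((s * (q 0 0 - p 0 0) + t * (r 0 0 - p 0 0)) * (r 0 1 - p 0 1)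
      - (s * (q 0 1 - p 0 1) + t * (r 0 1 - p 0 1)) * (r 0 0 - p 0 0)); first by ring.
  by rewrite h0 h1 !mul0r subrr.
transitivity ((s * (q 0 1 - p 0 1) + t * (r 0 1 - p 0 1)) * (q 0 0 - p 0 0)
    - (s * (q 0 0 - p 0 0) + t * (r 0 0 - p 0 0)) * (q 0 1 - p 0 1)); first by ring.
by rewrite h0 h1 !mul0r subrr.
Qed.

(** Moving the weight [e], the smaller of [a] and [b], from [q] to [p] or back gives two points of
    the triangle with the given midpoint; extremality makes them equal, so [2 * e] times [p - q]
    vanishes. *)
Lemma extreme_coef {R : realType} (p q r : 'rV[R]_2) (a b c : R) :
  0 < a -> 0 < b -> 0 <= c -> a + b + c = 1 ->
  extreme (conv3 p q r) (a *: p + b *: q + c *: r) -> p = q.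
Proof.
move=> a0 b0 c0 abc [_ hx]; pose e := Num.min a b.
have e0 : 0 < e by rewrite lt_min a0.
have ea : e <= a by rewrite ge_min lexx.
have eb : e <= b by rewrite ge_min lexx orbT.
have /rowP h : (a + e) *: p + (b - e) *: q + c *: r =
    (a - e) *: p + (b + e) *: q + c *: r.
  apply: hx.
  - by exists (a + e), (b - e), c; split=> //; lra.
  - by exists (a - e), (b + e), c; split=> //; lra.
  - by apply: row2P; rewrite !coordE; ring.
have e2 : 2 * e != 0 by rewrite mulf_neq0 ?lt0r_neq0.
by apply: row2P; apply: (mulfI e2); [have := h 0|have := h 1]; rewrite !coordE; lra.
Qed.

Lemma extreme_conv3 {R : realType} (p q r x : 'rV[R]_2) :
  cross p q r != 0 -> extreme (conv3 p q r) x -> [\/ x = p, x = q | x = r].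
Proof.
move=> /cross_neq0[pq pr qr] hx; have [a [b [c [a0 b0 c0 abc xE]]]] := hx.1.
move: hx; rewrite xE => hx.
have ab : ~ (0 < a /\ 0 < b) by move=> [? ?]; apply: pq; exact: extreme_coef hx.
have ac : ~ (0 < a /\ 0 < c).
  move=> [? ?]; apply: pr; move: hx; rewrite conv3_swap23 addrAC.
  by apply: extreme_coef => //; lra.
have bc : ~ (0 < b /\ 0 < c).
  move=> [? ?]; apply: qr; move: hx.
  rewrite conv3_swap12 conv3_swap23 -addrA addrC.
  by apply: extreme_coef => //; lra.
have z (u : R) : 0 <= u -> 0 < u \/ u = 0.
  by rewrite le_eqVlt => /predU1P[<-|]; [right|left].
case: (z a a0) => ha; [apply: Or31|case: (z b b0) => hb; [apply: Or32|apply: Or33]].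
- have [//|hb] := z b b0; first by move=> ?; case: ab.
  have [//|hc] := z c c0; first by move=> ?; case: ac.
  have -> : a = 1 by lra.
  by rewrite hb hc !scale0r scale1r !addr0.
- have [//|hc] := z c c0; first by move=> ?; case: bc.
  have -> : b = 1 by lra.
  by rewrite ha hc !scale0r scale1r addr0 add0r.
have -> : c = 1 by lra.
by rewrite ha hb !scale0r scale1r !add0r.
Qed.

(** If [p] is a midpoint, the summed weights of [q] and [r] vanish by linear independence; being
    nonnegative, each of them vanishes. *)
Lemma extreme_vertex {R : realType} (p q r : 'rV[R]_2) :
  cross p q r != 0 -> extreme (conv3 p q r) p.
Proof.
move=> D0; split; first exact: conv3_1.
move=> _ _ [a [b [c [a0 b0 c0 abc ->]]]] [a' [b' [c' [a0' b0' c0' abc' ->]]]] e.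
have [hb hc] : b + b' = 0 /\ c + c' = 0.
  apply: (cross_free p q r) => //.
  have aE : a = 1 - b - c by lra.
  have aE' : a' = 1 - b' - c' by lra.
  apply/eqP; rewrite -(subr_eq0 _ 0) subr0; apply/eqP.
  transitivity ((a *: p + b *: q + c *: r + (a' *: p + b' *: q + c' *: r)) - (p + p)).
    by rewrite aE aE'; apply: row2P; rewrite !coordE; ring.
  by rewrite -e subrr.
have -> : b = 0 by lra.
have -> : b' = 0 by lra.
have -> : c = 0 by lra.
have -> : c' = 0 by lra.
have -> : a = 1 by lra.
by have -> : a' = 1 by lra.
Qed.

Lemma cross_swap12 {R : realType} (p q r : 'rV[R]_2) : cross q p r = - cross p q r.
Proof. by rewrite /cross; ring. Qed.

Lemma cross_swap23 {R : realType} (p q r : 'rV[R]_2) : cross p r q = - cross p q r.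
Proof. by rewrite /cross; ring. Qed.

Lemma conv3_vertices {R : realType} (p q r p' q' r' : 'rV[R]_2) :
  cross p q r != 0 -> cross p' q' r' != 0 -> conv3 p q r = conv3 p' q' r' ->
  [/\ [\/ p = p', p = q' | p = r'], [\/ q = p', q = q' | q = r']
    & [\/ r = p', r = q' | r = r']].
Proof.
move=> D0 D0' e; split; apply: extreme_conv3 => //; rewrite -e.
- exact: extreme_vertex.
- by rewrite conv3_swap12; apply: extreme_vertex; rewrite cross_swap12 oppr_eq0.
- rewrite conv3_swap23 conv3_swap12; apply: extreme_vertex.
  by rewrite cross_swap12 cross_swap23 opprK.
Qed.

(** This makes the sorted sides an invariant of the set. Both vertex triples consist of the extreme
    points, so they differ by a permutation, and the order [b <= c <= a] fixes the values;
    assignments that repeat a vertex would give a zero side. *)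
Lemma shape_inj {R : realType} (A : set 'rV[R]_2) (a b c a' b' c' : R) :
  shape A a b c -> shape A a' b' c' -> [/\ a = a', b = b' & c = c'].
Proof.
move=> [hA g bc ca] [hA' g' bc' ca'].
have [a0 b0 c0] := sides_gt0 _ _ _ _ hA g.
move: hA hA' => [p [q [r [-> hpq hpr hqr]]]] [p' [q' [r' [e hpq' hpr' hqr']]]].
have D0 : cross p q r != 0 by rewrite -gram_gt0P hpq hpr hqr.
have D0' : cross p' q' r' != 0 by rewrite -gram_gt0P hpq' hpr' hqr'.
have := conv3_vertices _ _ _ _ _ _ D0 D0' e.
case=> -[] ? [] ? [] ?; subst p q r; rewrite ?sqdxx in hpq hpr hqr; try lra;
  rewrite ?(sqdC q' p') ?(sqdC r' p') ?(sqdC r' q') in hpq hpr hqr;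
  by split; lra.
Qed.

(** * Circumscribed rectangles *)

Lemma shape_diam_le {R : realType} (A : set 'rV[R]_2) (a b c : R) x y :
  shape A a b c -> A x -> A y -> sqd x y <= a.
Proof.
move=> [[p [q [r [-> hpq hpr hqr]]]] g bc ca] Ax Ay.
(* By [leibniz], the squared distance from [w] to a convex combination is at most the weighted mean
   of those to the vertices. The bound is used twice, once for each endpoint. *)
have le w z : sqd w p <= a -> sqd w q <= a -> sqd w r <= a ->
    conv3 p q r z -> sqd w z <= a.
  move=> wp wq wr [s [t [u [s0 t0 u0 stu ->]]]]; rewrite leibniz// hpq hpr hqr.
  have b0 : 0 <= b by rewrite -hpr sqd_ge0.
  have -> : s * sqd w p + t * sqd w q + u * sqd w r - s * t * a - s * u * b - t * u * c
    = a - (s * (a - sqd w p) + t * (a - sqd w q) + u * (a - sqd w r)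
        + s * t * a + s * u * b + t * u * c) + a * (s + t + u - 1) by ring.
  rewrite stu subrr mulr0 addr0 gerBl.
  by rewrite !addr_ge0// !mulr_ge0// ?subr_ge0//; lra.
have a0 : 0 <= a by rewrite -hpq sqd_ge0.
have ba := le_trans bc ca.
have vle v : conv3 p q r v -> [/\ sqd v p <= a, sqd v q <= a & sqd v r <= a].
  by move=> hv; split; rewrite sqdC; apply: le hv;
    rewrite ?sqdxx// ?(sqdC q p) ?(sqdC r p) ?(sqdC r q) ?hpq ?hpr ?hqr.
by have [? ? ?] := vle x Ax; apply: le Ay.
Qed.

Lemma perp_unit {R : realType} (v : 'rV[R]_2) : dot (perp v) (perp v) = dot v v.
Proof. by rewrite !dotE !coordE; ring. Qed.

Lemma sqd_frame {R : realType} (v x y : 'rV[R]_2) : dot v v = 1 ->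
  sqd x y = dot (x - y) v ^+ 2 + dot (x - y) (perp v) ^+ 2.
Proof.
by move=> v1; rewrite -[LHS]mulr1 -v1 sqdE !dotE !coordE; ring.
Qed.

(** Relabelling may reverse the orientation, so it is the square of [cross] that is preserved. *)
Lemma sort_vertices {R : realType} (l : 'rV[R]_2 -> R) (p q r : 'rV[R]_2) :
  exists p' q' r', [/\ conv3 p q r = conv3 p' q' r',
    cross p q r ^+ 2 = cross p' q' r' ^+ 2 & l p' <= l r' <= l q'].
Proof.
pose P p' q' r' := conv3 p q r = conv3 p' q' r' /\
  cross p q r ^+ 2 = cross p' q' r' ^+ 2.
have P12 u v w : P u v w -> P v u w.
  by move=> [e h]; split; [rewrite e; exact: conv3_swap12|rewrite h cross_swap12 sqrrN].
have P23 u v w : P u v w -> P u w v.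
  by move=> [e h]; split; [rewrite e; exact: conv3_swap23|rewrite h cross_swap23 sqrrN].
suff [p' [q' [r' [[? ?] ?]]]] : exists p' q' r', P p' q' r' /\ l p' <= l r' <= l q'.
  by exists p', q', r'; split.
have P0 : P p q r by [].
have [pq|/ltW qp] := leP (l p) (l q); have [qr|/ltW rq] := leP (l q) (l r);
  have [pr|/ltW rp] := leP (l p) (l r).
- by exists p, r, q; rewrite pq qr; split=> //; exact: P23.
- by exists r, q, p; rewrite rp pq; split=> //; exact: (P12 _ _ _ (P23 _ _ _ (P12 _ _ _ P0))).
- by exists p, q, r; rewrite pr rq.
- by exists r, q, p; rewrite rp pq; split=> //; exact: (P12 _ _ _ (P23 _ _ _ (P12 _ _ _ P0))).
- by exists q, r, p; rewrite qp pr; split=> //; exact: (P23 _ _ _ (P12 _ _ _ P0)).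
- by exists q, p, r; rewrite qr rp; split=> //; exact: P12.
- by exists r, p, q; rewrite rq qp; split=> //; exact: (P12 _ _ _ (P23 _ _ _ P0)).
- by exists r, p, q; rewrite rq qp; split=> //; exact: (P12 _ _ _ (P23 _ _ _ P0)).
Qed.

(** A linear form on a triangle takes its extreme values at vertices. *)
Lemma vertex_width {R : realType} (w x y p q r : 'rV[R]_2) :
  conv3 p q r x -> conv3 p q r y ->
  exists p' q' r', [/\ conv3 p q r = conv3 p' q' r',
    cross p q r ^+ 2 = cross p' q' r' ^+ 2 & dot (y - x) w <= dot (q' - p') w].
Proof.
move=> hx hy; have [p' [q' [r' [e eD /andP[pr rq]]]]] := sort_vertices (fun z => dot z w) p q r.
exists p', q', r'; split => //; move: hx hy; rewrite e.
have dotB u v : dot (u - v) w = dot u w - dot v w by rewrite !dotE !coordE; ring.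
have dot3 s t u : dot (s *: p' + t *: q' + u *: r') w
    = s * dot p' w + t * dot q' w + u * dot r' w by rewrite !dotE !coordE; ring.
move=> [s [t [u [s0 t0 u0 stu ->]]]] [s' [t' [u' [s0' t0' u0' stu' ->]]]].
rewrite !dotB !dot3.
have := mulr_ge0 u0 (_ : 0 <= dot r' w - dot p' w); rewrite subr_ge0 pr => /(_ isT).
have := mulr_ge0 t0 (_ : 0 <= dot q' w - dot p' w).
rewrite subr_ge0 (le_trans pr rq) => /(_ isT).
have := mulr_ge0 u0' (_ : 0 <= dot q' w - dot r' w); rewrite subr_ge0 rq => /(_ isT).
have := mulr_ge0 s0' (_ : 0 <= dot q' w - dot p' w).
rewrite subr_ge0 (le_trans pr rq) => /(_ isT).
have -> : s = 1 - t - u by lra.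
have -> : t' = 1 - s' - u' by lra.
lra.
Qed.

(** A triangle in a box has at most half its area. The determinant is a combination of the [x]'s
    whose coefficients are cyclic differences of the [y]'s; it is at most [W] times the sum of their
    positive parts, and that sum is the range of the [y]'s. *)
Lemma box_area {R : realType} (W H x1 x2 x3 y1 y2 y3 : R) :
  0 <= x1 <= W -> 0 <= x2 <= W -> 0 <= x3 <= W ->
  0 <= y1 <= H -> 0 <= y2 <= H -> 0 <= y3 <= H ->
  (x2 - x1) * (y3 - y1) - (x3 - x1) * (y2 - y1) <= W * H.
Proof.
move=> /andP[a1 b1] /andP[a2 b2] /andP[a3 b3] /andP[c1 d1] /andP[c2 d2] /andP[c3 d3].
have -> : (x2 - x1) * (y3 - y1) - (x3 - x1) * (y2 - y1) =
  x1 * (y2 - y3) + x2 * (y3 - y1) + x3 * (y1 - y2) by ring.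
have pos (x y : R) : 0 <= x <= W -> x * y <= W * Num.max y 0.
  move=> /andP[x0 xW]; have [y0|y0] := leP 0 y.
    by rewrite ler_wpM2r.
  by rewrite mulr0 nmulr_lle0.
have a (x y : R) : Num.max (x - y) 0 = Num.max x y - y.
  by have [h|h] := leP (x - y) 0; have [k|k] := leP x y; lra.
have W0 := le_trans a1 b1.
apply: (le_trans (lerD (lerD (pos x1 (y2 - y3) _) (pos x2 (y3 - y1) _)) (pos x3 (y1 - y2) _))).
all: rewrite ?a1 ?a2 ?a3//.
rewrite -!mulrDr ler_wpM2l// !a.
have [h1|h1] := leP y2 y3; have [h2|h2] := leP y3 y1; have [h3|h3] := leP y1 y2; lra.
Qed.

Lemma rpoint_dot {R : realType} (Q : rectangle R) x y :
  dot (rpoint Q x y - rcorner Q) (rdir Q) = x /\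
  dot (rpoint Q x y - rcorner Q) (perp (rdir Q)) = y.
Proof.
have u1 := rdir_unit Q.
by split; [rewrite -[RHS]mulr1|rewrite -[RHS]mulr1]; rewrite -u1 /rpoint !dotE !coordE; ring.
Qed.

Lemma rbody_dot {R : realType} (Q : rectangle R) z : rbody Q z ->
  0 <= dot (z - rcorner Q) (rdir Q) <= rlen Q /\
  0 <= dot (z - rcorner Q) (perp (rdir Q)) <= rwid Q.
Proof.
move=> [x hx [y hy <-]]; have [-> ->] := rpoint_dot Q x y.
by move: hx hy; rewrite /= !in_itv.
Qed.

Lemma circumscribed_area {R : realType} (Q : rectangle R) (p q r : 'rV[R]_2) :
  circumscribed (conv3 p q r) Q -> `|cross p q r| <= rlen Q * rwid Q.
Proof.
move=> [hb _].
have [xp yp] := rbody_dot _ _ (hb _ (conv3_1 p q r)).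
have [xq yq] := rbody_dot _ _ (hb _ (conv3_2 p q r)).
have [xr yr] := rbody_dot _ _ (hb _ (conv3_3 p q r)).
have crossE u v w : cross u v w =
    (dot (v - rcorner Q) (rdir Q) - dot (u - rcorner Q) (rdir Q))
    * (dot (w - rcorner Q) (perp (rdir Q)) - dot (u - rcorner Q) (perp (rdir Q)))
    - (dot (w - rcorner Q) (rdir Q) - dot (u - rcorner Q) (rdir Q))
    * (dot (v - rcorner Q) (perp (rdir Q)) - dot (u - rcorner Q) (perp (rdir Q))).
  by rewrite -[LHS]mulr1 -(rdir_unit Q) /cross !dotE !coordE; ring.
(* The two signs of the determinant correspond to the two orientations of the triangle. *)
by rewrite ler_norml lerNl -cross_swap23 !crossE !box_area.
Qed.

Lemma circumscribed_width {R : realType} (A : set 'rV[R]_2) (Q : rectangle R) :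
  circumscribed A Q ->
  (exists x y, [/\ A x, A y & dot (y - x) (rdir Q) = rlen Q]) /\
  (exists x y, [/\ A x, A y & dot (y - x) (perp (rdir Q)) = rwid Q]).
Proof.
have dotB (x y w : 'rV[R]_2) :
    dot (y - x) w = dot (y - rcorner Q) w - dot (x - rcorner Q) w.
  by rewrite !dotE !coordE; ring.
move=> [_ hs]; split.
- have [|x [Ax [y1 _ ex]]] := hs [set rpoint Q 0 y | y in `[0, rwid Q]%classic].
    by left; right.
  have [|y [Ay [y2 _ ey]]] := hs [set rpoint Q (rlen Q) y | y in `[0, rwid Q]%classic].
    by right.
  exists x, y; split=> //; rewrite dotB -ex -ey.
  by rewrite !(rpoint_dot Q _ _).1 subr0.
have [|x [Ax [x1 _ ex]]] := hs [set rpoint Q x 0 | x in `[0, rlen Q]%classic].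
  by left; left; left.
have [|y [Ay [x2 _ ey]]] := hs [set rpoint Q x (rwid Q) | x in `[0, rlen Q]%classic].
  by left; left; right.
exists x, y; split=> //; rewrite dotB -ex -ey.
by rewrite !(rpoint_dot Q _ _).2 subr0.
Qed.

Lemma short_dir_unit {R : realType} (Q : rectangle R) :
  dot (short_dir Q) (short_dir Q) = 1.
Proof. by rewrite /short_dir; case: ifP; rewrite ?perp_unit rdir_unit. Qed.

Lemma circumscribed_long {R : realType} (Q : rectangle R) (p q r : 'rV[R]_2) :
  circumscribed (conv3 p q r) Q ->
  exists p' q' r', [/\ conv3 p q r = conv3 p' q' r',
    cross p q r ^+ 2 = cross p' q' r' ^+ 2 &
    Num.max (rlen Q) (rwid Q) <= dot (q' - p') (perp (short_dir Q))].
Proof.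
move=> /circumscribed_width[[x [y [hx hy xy]]] [x' [y' [hx' hy' xy']]]].
rewrite /short_dir; case: leP => _; first by rewrite -xy'; exact: vertex_width.
(* Here the short direction is [perp (rdir Q)], and [perp] applied twice is negation, so the two
   touching points change roles. *)
rewrite -xy; have -> : dot (y - x) (rdir Q) = dot (x - y) (perp (perp (rdir Q))).
  by rewrite !dotE !coordE; ring.
exact: vertex_width.
Qed.

(** The ratio times the squared long side [M ^ 2] is the area of the rectangle, so the area bound
    and [M ^ 2 <= a] together give the estimate. The equality case tells which side of the triangle
    the rectangle lies along. *)
Lemma extremal_long {R : realType} (Q : rectangle R) (A : set 'rV[R]_2) (a b c : R) :
  shape A a b c -> circumscribed A Q ->
  let d := Num.sqrt (gram a b c) / 2 in
  d / a <= rratio Q /\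
  (rratio Q = d / a -> exists p q r, [/\ A = conv3 p q r,
    4 * cross p q r ^+ 2 = gram a b c, sqd p q = a & dot (q - p) (short_dir Q) = 0]).
Proof.
move=> hA hQ d; have [hs g bc ca] := hA.
have [a0 b0 c0] := sides_gt0 _ _ _ _ hs g.
have [p1 [q1 [r1 [AE hpq hpr hqr]]]] := hs.
have [p [q [r [AE' eD hM]]]] : exists p' q' r', [/\ conv3 p1 q1 r1 = conv3 p' q' r',
    cross p1 q1 r1 ^+ 2 = cross p' q' r' ^+ 2 &
    Num.max (rlen Q) (rwid Q) <= dot (q' - p') (perp (short_dir Q))].
  by apply: circumscribed_long; rewrite -AE.
have gE : 4 * cross p q r ^+ 2 = gram a b c by rewrite -eD -gram_sqd hpq hpr hqr.
have dE : d = `|cross p q r|.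
  have -> : d = Num.sqrt ((2 * cross p q r) ^+ 2) / 2.
    by rewrite /d -gE; congr (Num.sqrt _ / _); ring.
  by rewrite sqrtr_sqr normrM gtr0_norm// mulrC mulKf.
have d0 : 0 < d by rewrite divr_gt0// sqrtr_gt0.
have dWH : d <= rlen Q * rwid Q.
  by rewrite dE; apply: circumscribed_area; rewrite -AE' -AE.
set M := Num.max _ _ in hM.
have M0 : 0 < M by rewrite lt_max rlen_gt0.
have MWH : rratio Q * M ^+ 2 = rlen Q * rwid Q.
  have hl := rlen_gt0 Q; have hw := rwid_gt0 Q.
  by rewrite /rratio /M; have [_|_] := leP (rlen Q) (rwid Q); field; rewrite lt0r_neq0.
set m := dot _ _ in hM.
have pq_frame : sqd p q = dot (q - p) (short_dir Q) ^+ 2 + m ^+ 2.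
  by rewrite sqdC (sqd_frame _ _ _ (short_dir_unit Q)).
have pqa : sqd p q <= a.
  by apply: (shape_diam_le A a b c) => //; rewrite AE AE'; [exact: conv3_1|exact: conv3_2].
have Mm : M ^+ 2 <= m ^+ 2 by rewrite ler_sqr// nnegrE ltW// (lt_le_trans M0 hM).
have Ma : M ^+ 2 <= a by have := sqr_ge0 (dot (q - p) (short_dir Q)); lra.
have r0 : 0 < rratio Q.
  by rewrite -(pmulr_lgt0 _ (exprn_gt0 2 M0)) MWH mulr_gt0 ?rlen_gt0 ?rwid_gt0.
split.
  rewrite ler_pdivrMr// (le_trans dWH)// -MWH.
  by rewrite ler_pM2l.
move=> e; exists p, q, r.
(* At equality the area bound becomes [a <= M ^ 2], while [M ^ 2] is at most [m ^ 2], the squared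
   component of [q - p] along the long sides. Since [sqd p q <= a], nothing is left for the
   component along [short_dir]. *)
have aM : a <= M ^+ 2 by rewrite -(ler_pM2l r0) MWH {1}e divfK ?lt0r_neq0.
have hs0 : dot (q - p) (short_dir Q) ^+ 2 = 0.
  by apply/eqP; rewrite eq_le sqr_ge0 andbT; lra.
split => //; first by rewrite AE.
  by apply/eqP; rewrite eq_le pqa /=; lra.
by apply/eqP; rewrite -sqrf_eq0 hs0.
Qed.

(** * The affinity of an extremal rectangle *)

Lemma orth_affinity_sqd {R : realType} (v x y : 'rV[R]_2) (c : R) : dot v v = 1 ->
  sqd (orth_affinity v c x) (orth_affinity v c y) =
    c ^+ 2 * sqd x y + (1 - c ^+ 2) * dot (x - y) v ^+ 2.
Proof.
move=> v1; pose al := dot (x - y) v.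
transitivity (al ^+ 2 * (1 - c) ^+ 2 * dot v v + 2 * c * (1 - c) * al ^+ 2 + c ^+ 2 * sqd x y).
  by rewrite /al sqdE [sqd x y]sqdE /orth_affinity !dotE !coordE; ring.
by rewrite v1 /al; ring.
Qed.

Lemma orth_affinity_conv3 {R : realType} (v p q r : 'rV[R]_2) (k : R) :
  orth_affinity v k @` conv3 p q r =
  conv3 (orth_affinity v k p) (orth_affinity v k q) (orth_affinity v k r).
Proof.
by apply: conv3_image => a b c _; apply: row2P; rewrite /orth_affinity !dotE !coordE; ring.
Qed.

(** The base [p q] is orthogonal to the axis and shrinks by [k], while the altitude is kept. The
    hypothesis on [gram] says that the altitude is [k] times the base, so the image has equal base
    and altitude; the foot still divides the base at [t]. *)
Lemma orth_affinity_sides {R : realType} (v p q r : 'rV[R]_2) (k a b c : R) :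
  dot v v = 1 -> dot (q - p) v = 0 -> 0 < sqd p q ->
  sqd p q = a -> sqd p r = b -> sqd q r = c ->
  4 * (k * a) ^+ 2 = gram a b c ->
  let t := (a + b - c) / (2 * a) in
  sides (orth_affinity v k @` conv3 p q r)
    (k ^+ 2 * a) (k ^+ 2 * a * (1 + t ^+ 2)) (k ^+ 2 * a * (1 + (1 - t) ^+ 2)).
Proof.
move=> v1 hv s0 ha hb hc hk t.
have a0 : a != 0 by rewrite -ha lt0r_neq0.
(* Base times altitude is twice the area. *)
have aD : a * dot (r - p) v ^+ 2 = cross p q r ^+ 2.
  pose l := dot (q - p) (perp v).
  have -> : cross p q r = cross p q r * dot v v by rewrite v1 mulr1.
  have -> : cross p q r * dot v v =
      - l * dot (r - p) v + dot (q - p) v * dot (r - p) (perp v).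
    by rewrite /l /cross !dotE !coordE; ring.
  rewrite hv mul0r addr0 exprMn sqrrN; congr (_ * _).
  by rewrite -ha sqdC (sqd_frame v)// hv expr0n add0r.
have gE : gram a b c = 4 * cross p q r ^+ 2 by rewrite -gram_sqd ha hb hc.
have hE : dot (r - p) v ^+ 2 = k ^+ 2 * a.
  by apply: (mulfI a0); rewrite aD; lra.
have hpr : dot (p - r) v ^+ 2 = k ^+ 2 * a.
  by rewrite -hE !dotE !coordE; ring.
have hqr : dot (q - r) v ^+ 2 = k ^+ 2 * a.
  have -> : dot (q - r) v = dot (q - p) v + dot (p - r) v by rewrite !dotE !coordE; ring.
  by rewrite hv add0r.
have bE : b = k ^+ 2 * a + t ^+ 2 * a.
  have -> : k ^+ 2 = gram a b c / (4 * a ^+ 2) by rewrite -hk; field.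
  by rewrite /t /gram; field.
have cE : c = a + b - 2 * t * a by rewrite /t; field.
exists (orth_affinity v k p), (orth_affinity v k q), (orth_affinity v k r).
split; rewrite ?orth_affinity_conv3// orth_affinity_sqd//.
- have -> : dot (p - q) v = - dot (q - p) v by rewrite !dotE !coordE; ring.
  by rewrite hv ha; ring.
- by rewrite hpr hb bE; ring.
- by rewrite hqr hc cE bE; ring.
Qed.

(** The rectangle has a side along the longest side [p q] and the altitude from [r] as its width. It
    is not a square, which also rules out strong invariance. *)
Lemma extremal_exists {R : realType} (A : set 'rV[R]_2) (a b c : R) :
  shape A a b c ->
  exists Q : rectangle R, [/\ circumscribed A Q,
    rratio Q = Num.sqrt (gram a b c) / 2 / a & rlen Q <> rwid Q].
Proof.
move=> hA; have [hs g bc ca] := hA.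
have [a0 b0 c0] := sides_gt0 _ _ _ _ hs g; clear hA.
have : b <= a /\ c <= a by split=> //; exact: le_trans ca.
have [p [q [r [-> hpq hpr hqr]]]] := hs; clear bc ca hs.
(* Positive orientation makes [perp (q - p)] point towards [r]. Exchanging [p] and [q] exchanges [b]
   and [c], so only their bounds by [a] have been kept. *)
wlog D0 : p q b c g b0 c0 hpq hpr hqr / 0 < cross p q r.
  move=> w [ba ca]; have : cross p q r != 0 by rewrite -gram_gt0P hpq hpr hqr.
  rewrite neq_lt => /orP[D0|D0]; last by apply: w.
  rewrite conv3_swap12 gram_swap12; apply: (w q p) => //.
  - by rewrite gram_swap12.
  - by rewrite sqdC.
  - by rewrite cross_swap12 oppr_gt0.
move=> [ba ca]; pose s := Num.sqrt a; pose D := cross p q r.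
have s0 : 0 < s by rewrite sqrtr_gt0.
have sn : s != 0 by rewrite lt0r_neq0.
have s2 : s ^+ 2 = a by rewrite sqr_sqrtr ?ltW.
have gE : gram a b c = (2 * D) ^+ 2 by rewrite -hpq -hpr -hqr gram_sqd /D; ring.
have dE : Num.sqrt (gram a b c) / 2 = D.
  by rewrite gE sqrtr_sqr normrM !gtr0_norm// mulrC mulKf.
have u1 : dot (s^-1 *: (q - p)) (s^-1 *: (q - p)) = 1.
  have -> : dot (s^-1 *: (q - p)) (s^-1 *: (q - p)) = s ^- 2 * sqd p q.
    by rewrite sqdE !dotE !coordE; field.
  by rewrite hpq -s2 mulVf// expf_neq0.
have H0 : 0 < D / s by rewrite divr_gt0.
pose Q := @Rectangle R p (s^-1 *: (q - p)) s (D / s) u1 s0 H0.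
have Da : D < a.
  (* Since [a * b <= a ^ 2] and [a + b - c >= b > 0], the value [gram a b c] is strictly below
     [4 * a ^ 2]. *)
  suff : D ^+ 2 < a ^+ 2 by rewrite ltr_sqr ?nnegrE ?ltW.
  have -> : D ^+ 2 = gram a b c / 4 by rewrite gE; field.
  by rewrite /gram; nra.
have Hs : D / s < s by rewrite ltr_pdivrMr// -expr2 s2.
pose t := (a + b - c) / (2 * a).
(* No angle at an end of a longest side is obtuse, so the foot of the altitude lies on that side. *)
have t01 : 0 <= t <= 1.
  by rewrite divr_ge0 ?ler_pdivrMr ?mulr_gt0 ?mulr_ge0//=; lra.
have /andP[t0 t1] := t01.
have tE : t * s ^+ 2 = dot (q - p) (r - p).
  by rewrite /t s2 -hpq -hpr -hqr !sqdE !dotE !coordE; field; move: a0; rewrite -hpq sqdE => /lt0r_neq0.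
have pE : p = rpoint Q 0 0 by rewrite /rpoint !scale0r !addr0.
have qE : q = rpoint Q s 0.
  by rewrite /rpoint scale0r addr0 scalerA divff// scale1r addrC subrK.
have rE : r = rpoint Q (t * s) (D / s).
  have hs2 : s ^+ 2 = sqd p q by rewrite s2.
  rewrite /rpoint /=.
  have a1 : sqd p q != 0 by rewrite hpq lt0r_neq0.
  have -> : t * s *: (s^-1 *: (q - p)) = (dot (q - p) (r - p) / s ^+ 2) *: (q - p).
    by rewrite -tE scalerA; congr (_ *: _); field.
  have -> : D / s *: perp (s^-1 *: (q - p)) = (D / s ^+ 2) *: perp (q - p).
    by apply: row2P; rewrite !coordE; field.
  rewrite hs2; move: a1; rewrite /D sqdE => a1.
  by apply: row2P; rewrite /cross dotE !coordE; field.
exists Q; split.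
- split.
    move=> z [x [y [w [x0 y0 w0 xyw ->]]]].
    exists (y * s + w * (t * s)); last exists (w * (D / s)).
    + have wt : w * t <= w by rewrite ler_piMr.
      rewrite /= in_itv /= mulrA -mulrDl ger_pMl// mulr_ge0 ?(ltW s0)//=; first by lra.
      by rewrite addr_ge0// mulr_ge0.
    + by rewrite /= in_itv /= mulr_ge0 ?(ltW H0)//= ler_piMl ?(ltW H0)//; lra.
    + have -> : x = 1 - y - w by lra.
      by rewrite [in RHS]qE [in RHS]rE /rpoint; apply: row2P; rewrite !coordE; ring.
  move=> S [[[->|->]|->]|->].
  + exists p; split; [exact: conv3_1|exists 0 => //=].
    by rewrite in_itv /= lexx ltW.
  + exists r; split; [exact: conv3_3|exists (t * s); rewrite ?[RHS]rE//=].
    by rewrite in_itv /=; rewrite mulr_ge0 ?(ltW s0)//= ler_piMl// ltW.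
  + exists p; split; [exact: conv3_1|exists 0 => //=].
    by rewrite in_itv /= lexx ltW.
  + exists q; split; [exact: conv3_2|exists 0 => //=].
    by rewrite in_itv /= lexx ltW.
- rewrite /rratio /= min_r ?max_l ?(ltW Hs)// dE -s2; field.
  exact: sn.
- by move=> /= e; move: Hs; rewrite -e ltxx.
Qed.

Lemma extremalP {R : realType} (A : set 'rV[R]_2) (a b c : R) (Q : rectangle R) :
  shape A a b c ->
  extremal A Q <-> circumscribed A Q /\ rratio Q = Num.sqrt (gram a b c) / 2 / a.
Proof.
move=> hA; have [Q0 [hc0 hr0 _]] := extremal_exists _ _ _ _ hA.
suff e : inf [set rratio Q' | Q' in circumscribed A] = Num.sqrt (gram a b c) / 2 / a.
  by rewrite /extremal e.
have lb : lbound [set rratio Q' | Q' in circumscribed A] (rratio Q0).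
  by move=> _ [Q' hQ' <-]; rewrite hr0; exact: (extremal_long _ _ _ _ _ hA hQ').1.
rewrite -hr0; apply/eqP; rewrite eq_le lb_le_inf//; last first.
  by exists (rratio Q0), Q0.
by rewrite andbT; apply: ge_inf; [exists (rratio Q0)|exists Q0].
Qed.

(** The similarity class of the image does not depend on the extremal rectangle, even when several
    sides are longest. *)
Lemma extremal_sides {R : realType} (A : set 'rV[R]_2) (a b c : R) (Q : rectangle R) :
  shape A a b c -> extremal A Q ->
  let t := (a + b - c) / (2 * a) in
  exists2 k, 0 < k &
    sides (raff Q @` A) k (k * (1 + t ^+ 2)) (k * (1 + (1 - t) ^+ 2)).
Proof.
move=> hA /(extremalP _ _ _ _ _ hA)[hQ hr] t; have [hs g bc ca] := hA.
have [a0 b0 c0] := sides_gt0 _ _ _ _ hs g.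
have [p [q [r [AE gE hpq hv]]]] := (extremal_long _ _ _ _ _ hA hQ).2 hr.
have r0 : 0 < rratio Q by rewrite hr !divr_gt0// sqrtr_gt0.
have hk : 4 * (rratio Q * a) ^+ 2 = gram a b c.
  rewrite hr divfK ?lt0r_neq0// expr_div_n sqr_sqrtr ?ltW//.
  by field.
have ge : gram a (sqd p r) (sqd q r) = gram a b c by rewrite -gE -gram_sqd hpq.
have hps : sides (raff Q @` A) (rratio Q ^+ 2 * a)
    (rratio Q ^+ 2 * a * (1 + ((a + sqd p r - sqd q r) / (2 * a)) ^+ 2))
    (rratio Q ^+ 2 * a * (1 + (1 - (a + sqd p r - sqd q r) / (2 * a)) ^+ 2)).
  by rewrite AE; apply: orth_affinity_sides; rewrite ?short_dir_unit ?hpq ?ge.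
have pA : A p by rewrite AE; exact: conv3_1.
have qA : A q by rewrite AE; exact: conv3_2.
have rA : A r by rewrite AE; exact: conv3_3.
have hs' : sides A a (sqd p r) (sqd q r) by exists p, q, r.
exists (rratio Q ^+ 2 * a); first by rewrite mulr_gt0 ?exprn_gt0.
(* The side found may be another longest side or be labelled backwards. By [shape_inj] its two
   companions are still [b] and [c] in some order; the reversed order replaces [t] by [1 - t]. *)
have := sides_max_shape _ _ _ _ hs'; rewrite ge.
move=> /(_ g (shape_diam_le _ _ _ _ _ _ hA pA rA) (shape_diam_le _ _ _ _ _ _ hA qA rA)).
case=> /(shape_inj _ _ _ _ _ _ _ hA)[_ bE cE]; move: hps; rewrite -bE -cE //.
move/sides_swap12; congr sides; congr (_ * (1 + _ ^+ 2)); rewrite /t; field.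
all: exact: lt0r_neq0.
Qed.

(** * The iteration on the parameter *)

Definition step {R : realType} (x : R) : R := (1 - x) / (1 + (1 - x) ^+ 2).

Lemma sqr1_gt0 {R : realType} (x : R) : 0 < 1 + x ^+ 2.
Proof. by rewrite ltr_pwDl// sqr_ge0. Qed.

Lemma x0_root {R : realType} : x0 R ^+ 3 - 2 * x0 R ^+ 2 + 3 * x0 R - 1 = 0.
Proof.
rewrite /x0; set s := Num.sqrt 69; set c := cbrt _.
have s2 : s ^+ 2 = 69 by rewrite sqr_sqrtr.
have C0 : 0 < 44 + 12 * s by rewrite ltr_pwDl// mulr_ge0// sqrtr_ge0.
have c0 : c != 0 by rewrite lt0r_neq0// powR_gt0.
have c3 : c ^+ 3 = 44 + 12 * s.
  by rewrite /c /cbrt -powR_mulrn ?powR_ge0// -powRrM mulVf ?powRr1 ?ltW//.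
(* Cardano's resolvent: [44 + 12 * s] is a root of [z ^ 2 - 88 * z - 8000]. *)
have -> : (2 / 3 - c / 6 + 10 / (3 * c)) ^+ 3 - 2 * (2 / 3 - c / 6 + 10 / (3 * c)) ^+ 2
    + 3 * (2 / 3 - c / 6 + 10 / (3 * c)) - 1
    = (8000 - c ^+ 3 * (c ^+ 3 - 88)) / (216 * c ^+ 3) by field.
have -> : 8000 - c ^+ 3 * (c ^+ 3 - 88) = 0.
  rewrite c3; transitivity (144 * (69 - s ^+ 2)); first by ring.
  by rewrite s2 subrr mulr0.
by rewrite mul0r.
Qed.

Lemma x0_itv {R : realType} : 0 <= x0 R <= 1 / 2.
Proof.
have := @x0_root R; move: (x0 R) => x h; apply/andP; split; rewrite leNgt; apply/negP => hx.
  have := sqr_ge0 x; have : 0 <= x ^+ 2 * (- x) by rewrite mulr_ge0 ?sqr_ge0// oppr_ge0 ltW.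
  lra.
(* Division by [x - 1 / 2]: the cubic is [1 / 8] at [1 / 2] and the quotient is positive, so no root
   exceeds [1 / 2]. *)
have e : x ^+ 3 - 2 * x ^+ 2 + 3 * x - 1 =
  (x - 1 / 2) * ((x - 3 / 4) ^+ 2 + 27 / 16) + 1 / 8 by field.
have : 0 < (x - 1 / 2) * ((x - 3 / 4) ^+ 2 + 27 / 16).
  by rewrite mulr_gt0 ?subr_gt0// ltr_wpDl ?sqr_ge0.
by rewrite e in h; lra.
Qed.

Lemma step_fixP {R : realType} (t : R) : step t = t <-> t = x0 R.
Proof.
have fixE : step t = t <-> t ^+ 3 - 2 * t ^+ 2 + 3 * t - 1 = 0.
  have n0 := lt0r_neq0 (sqr1_gt0 (1 - t)).
  have -> : t ^+ 3 - 2 * t ^+ 2 + 3 * t - 1 = t * (1 + (1 - t) ^+ 2) - (1 - t) by ring.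
  split=> h; first by rewrite -{1}h /step divfK// subrr.
  by apply: (mulIf n0); rewrite /step divfK//; lra.
rewrite fixE; split=> [h|->]; last exact: x0_root.
have := @x0_root R; move: (x0 R) => y hy; apply/eqP; rewrite -subr_eq0.
(* The divided difference of the cubic; its positivity leaves only one real root. *)
have q0 : 0 < t ^+ 2 + t * y + y ^+ 2 - 2 * (t + y) + 3.
  have -> : t ^+ 2 + t * y + y ^+ 2 - 2 * (t + y) + 3 =
    3 / 4 * (t + y - 4 / 3) ^+ 2 + 1 / 4 * (t - y) ^+ 2 + 5 / 3 by field.
  by rewrite ltr_wpDl// addr_ge0// mulr_ge0// sqr_ge0.
rewrite -(mulrI_eq0 _ (lregP (lt0r_neq0 q0))); apply/eqP.
transitivity ((t ^+ 3 - 2 * t ^+ 2 + 3 * t - 1) - (y ^+ 3 - 2 * y ^+ 2 + 3 * y - 1)).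
  by ring.
by rewrite h hy subrr.
Qed.

Lemma step_itv {R : realType} (t : R) : 0 <= t <= 1 / 2 -> 0 <= step t <= 1 / 2.
Proof.
move=> /andP[t0 t1]; have s0 := sqr1_gt0 (1 - t).
rewrite /step divr_ge0 ?(ltW s0)//=; last by lra.
by rewrite ler_pdivrMr//; have := sqr_ge0 t; nra.
Qed.

Lemma step_sub {R : realType} (x y : R) : step x - step y =
  (y - x) * (1 - (1 - x) * (1 - y)) / ((1 + (1 - x) ^+ 2) * (1 + (1 - y) ^+ 2)).
Proof.
by rewrite /step; field; rewrite !lt0r_neq0 ?sqr1_gt0.
Qed.

(** By [step_sub], distinct points with equal images satisfy [x + y = x * y], which on this interval
    forces both to be zero. *)
Lemma step_inj {R : realType} (x y : R) : 0 <= x <= 1 / 2 -> 0 <= y <= 1 / 2 ->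
  step x = step y -> x = y.
Proof.
move=> /andP[a1 b1] /andP[a2 b2] /eqP; rewrite -subr_eq0 step_sub.
rewrite !mulf_eq0 invr_eq0 mulf_eq0 !(gt_eqF (sqr1_gt0 _)) !orbF subr_eq0.
case/orP => /eqP h; first by rewrite h.
have : x + y = x * y by lra.
have := mulr_ge0 a1 a2; nra.
Qed.

Lemma step_contract {R : realType} (x y : R) : 0 <= x <= 1 / 2 -> 0 <= y <= 1 / 2 ->
  `|step x - step y| <= 2^-1 * `|x - y|.
Proof.
move=> /andP[a1 b1] /andP[a2 b2]; rewrite step_sub -mulrA normrM (distrC y) mulrC.
rewrite ler_wpM2r// ger0_norm; last first.
  by rewrite divr_ge0 ?mulr_ge0 ?(ltW (sqr1_gt0 _))//; nra.
rewrite ler_pdivrMr ?mulr_gt0 ?sqr1_gt0//.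
(* With [u] and [v] at least [1 / 2], the numerator [1 - u * v] is at most [3 / 4] and the
   denominator at least [25 / 16]; the quotient [12 / 25] is below [1 / 2]. *)
pose u := 1 - x; pose v := 1 - y; rewrite -/u -/v.
have hu : 1 / 2 <= u by rewrite /u; lra.
have hv : 1 / 2 <= v by rewrite /v; lra.
have u2 : 1 / 4 <= u ^+ 2 by nra.
have v2 : 1 / 4 <= v ^+ 2 by nra.
have uv : 1 / 4 <= u * v by nra.
nra.
Qed.

(** * The parameter of a triangle and the triangles with equal base and altitude *)

Lemma shape_tau_itv {R : realType} (A : set 'rV[R]_2) (a b c : R) :
  shape A a b c -> 0 <= (a + b - c) / (2 * a) <= 1 / 2.
Proof.
move=> [hs g bc ca]; have [a0 b0 c0] := sides_gt0 _ _ _ _ hs g.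
by rewrite divr_ge0 ?ler_pdivrMr ?mulr_gt0//=; lra.
Qed.

(** This is where [step] comes from: in the image the base is shortest, and the parameter is read
    off again from the new longest side. *)
Lemma tau_step {R : realType} (k t : R) : k != 0 ->
  (k * (1 + (1 - t) ^+ 2) + k - k * (1 + t ^+ 2)) / (2 * (k * (1 + (1 - t) ^+ 2)))
  = step t.
Proof.
by move=> k0; rewrite /step; field; rewrite k0 lt0r_neq0 ?sqr1_gt0.
Qed.

Lemma gram_unit {R : realType} (t : R) :
  gram 1 (1 + t ^+ 2) (1 + (1 - t) ^+ 2) = 4.
Proof. by rewrite /gram; ring. Qed.

(** Since [t <= 1 / 2], the longest side joins the apex to the end of the base farther from the
    foot. *)
Lemma sides_unit_shape {R : realType} (A : set 'rV[R]_2) (k t : R) :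
  0 < k -> 0 <= t <= 1 / 2 ->
  sides A k (k * (1 + t ^+ 2)) (k * (1 + (1 - t) ^+ 2)) ->
  shape A (k * (1 + (1 - t) ^+ 2)) k (k * (1 + t ^+ 2)).
Proof.
move=> k0 /andP[t0 t1] h; split.
- exact/sides_swap23/sides_swap12.
- rewrite gram_swap23 gram_swap12 -[X in gram X](mulr1 k) gramZ gram_unit.
  by rewrite mulr_gt0// exprn_gt0.
- by rewrite ler_peMr ?(ltW k0)// lerDl sqr_ge0.
- by rewrite ler_pM2l// lerD2l; nra.
Qed.

Lemma sides_unit_triangle {R : realType} (l t : R) :
  sides (conv3 (l *: pt 0 0) (l *: pt 1 0) (l *: pt t 1))
    (l ^+ 2) (l ^+ 2 * (1 + t ^+ 2)) (l ^+ 2 * (1 + (1 - t) ^+ 2)).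
Proof.
by do 3 eexists; split; first reflexivity; rewrite sqdE !coordE; ring.
Qed.

Lemma sides_T0 {R : realType} :
  sides (T0 R) 1 (1 + x0 R ^+ 2) (1 + (1 - x0 R) ^+ 2).
Proof.
have := @sides_unit_triangle R 1 (x0 R).
by rewrite !scale1r expr1n !mul1r.
Qed.

Lemma sides_similar_T0 {R : realType} (A : set 'rV[R]_2) (k : R) : 0 < k ->
  sides A k (k * (1 + x0 R ^+ 2)) (k * (1 + (1 - x0 R) ^+ 2)) ->
  similar_sets A (T0 R).
Proof.
move=> k0 h; apply: (sides_similar _ _ k^-1 _ _ _ _ h).
- by rewrite invr_gt0.
- by rewrite -[X in gram X](mulr1 k) gramZ gram_unit mulr_gt0// exprn_gt0.
- by rewrite !mulKf ?mulVf ?lt0r_neq0//; exact: sides_T0.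
Qed.

Lemma diamE {R : realType} (A : set 'rV[R]_2) (a b c : R) :
  shape A a b c -> diam A = Num.sqrt a.
Proof.
move=> hA; have [[p [q [r [AE hpq _ _]]]] _ _ _] := hA.
have ub : ubound [set eucl_dist x y | x in A & y in A] (Num.sqrt a).
  by move=> _ [x Ax [y Ay <-]]; rewrite ler_wsqrtr//; exact: (shape_diam_le _ _ _ _ _ _ hA Ax Ay).
have Aa : [set eucl_dist x y | x in A & y in A] (Num.sqrt a).
  by rewrite -hpq AE; exists p; [exact: conv3_1|exists q; [exact: conv3_2|]].
apply/eqP; rewrite eq_le ge_sup//=; last by exists (Num.sqrt a).
by apply: ub_le_sup => //; exists (Num.sqrt a).
Qed.

Lemma shape_scale {R : realType} (A B : set 'rV[R]_2) (k a b c : R) :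
  0 < k -> shape A a b c -> sides B (k * a) (k * b) (k * c) ->
  shape B (k * a) (k * b) (k * c).
Proof.
move=> k0 [_ g bc ca] h; split=> //; rewrite ?ler_pM2l//.
by rewrite gramZ mulr_gt0// exprn_gt0.
Qed.

Lemma normalize_shape {R : realType} (A : set 'rV[R]_2) (a b c : R) :
  shape A a b c -> shape (normalize A) 1 (b / a) (c / a).
Proof.
move=> hA; have [hs g _ _] := hA; have [a0 _ _] := sides_gt0 _ _ _ _ hs g.
have := @shape_scale R A (normalize A) a^-1 a b c.
rewrite mulVf ?lt0r_neq0// ![a^-1 * _]mulrC; apply => //; first by rewrite invr_gt0.
have := @scaling_sides R (fun x => (diam A)^-1 *: x) a^-1 A a b c.
rewrite mulVf ?lt0r_neq0// ![a^-1 * _]mulrC; apply => // x y.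
have -> : a^-1 = (diam A)^-1 ^+ 2 by rewrite (diamE _ _ _ _ hA) exprVn sqr_sqrtr ?ltW.
by rewrite !sqdE !coordE; ring.
Qed.

(** * Hausdorff distance *)

(** The displacement of a barycentre is the barycentre of the vertex displacements; [leibniz] from
    the origin bounds its length. *)
Lemma sqd_conv3_le {R : realType} (p q r p' q' r' : 'rV[R]_2) (a b c m : R) :
  0 <= a -> 0 <= b -> 0 <= c -> a + b + c = 1 ->
  sqd p p' <= m -> sqd q q' <= m -> sqd r r' <= m ->
  sqd (a *: p + b *: q + c *: r) (a *: p' + b *: q' + c *: r') <= m.
Proof.
move=> a0 b0 c0 abc hp hq hr.
have sub0 u v : sqd u v = sqd (0 : 'rV[R]_2) (u - v).
  by rewrite !sqdE !coordE !mxE; ring.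
rewrite sub0.
have -> : a *: p + b *: q + c *: r - (a *: p' + b *: q' + c *: r') =
    a *: (p - p') + b *: (q - q') + c *: (r - r').
  by apply: row2P; rewrite !coordE; ring.
rewrite leibniz// -!sub0.
have := mulr_ge0 (mulr_ge0 a0 b0) (sqd_ge0 (p - p') (q - q')).
have := mulr_ge0 (mulr_ge0 a0 c0) (sqd_ge0 (p - p') (r - r')).
have := mulr_ge0 (mulr_ge0 b0 c0) (sqd_ge0 (q - q') (r - r')).
have := ler_wpM2l a0 hp; have := ler_wpM2l b0 hq; have := ler_wpM2l c0 hr.
have : m = a * m + b * m + c * m by rewrite -!mulrDl abc mul1r.
lra.
Qed.

(** The point with the same barycentric weights in the other triangle is within [e]. *)
Lemma dist_to_itv {R : realType} (p q r p' q' r' x : 'rV[R]_2) (e : R) : 0 <= e ->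
  sqd p p' <= e ^+ 2 -> sqd q q' <= e ^+ 2 -> sqd r r' <= e ^+ 2 ->
  conv3 p q r x -> 0 <= dist_to (conv3 p' q' r') x <= e.
Proof.
move=> e0 hp hq hr [a [b [c [a0 b0 c0 abc ->]]]].
set z := _ + c *: r; pose z' := a *: p' + b *: q' + c *: r'.
have hz : conv3 p' q' r' z' by exists a, b, c.
have lb : lbound [set eucl_dist z y | y in conv3 p' q' r'] 0.
  by move=> _ [y _ <-]; exact: sqrtr_ge0.
rewrite /dist_to lb_le_inf//=; last by exists (eucl_dist z z'), z'.
apply: (@le_trans _ _ (eucl_dist z z')); first by apply: ge_inf; [exists 0|exists z'].
rewrite eucl_distE -[leRHS](ger0_norm e0) -sqrtr_sqr ler_wsqrtr//.
exact: sqd_conv3_le.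
Qed.

Lemma hausdorff_itv {R : realType} (p q r p' q' r' : 'rV[R]_2) (e : R) : 0 <= e ->
  sqd p p' <= e ^+ 2 -> sqd q q' <= e ^+ 2 -> sqd r r' <= e ^+ 2 ->
  0 <= hausdorff (conv3 p q r) (conv3 p' q' r') <= e.
Proof.
move=> e0; have half (u v w u' v' w' : 'rV[R]_2) :
    sqd u u' <= e ^+ 2 -> sqd v v' <= e ^+ 2 -> sqd w w' <= e ^+ 2 ->
    0 <= sup [set dist_to (conv3 u' v' w') x | x in conv3 u v w] <= e.
  move=> hu hv hw; pose D := dist_to (conv3 u' v' w').
  have hD x : conv3 u v w x -> 0 <= D x <= e by exact: dist_to_itv.
  have ub : ubound [set D x | x in conv3 u v w] e.
    by move=> _ [x /hD /andP[_ ?] <-].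
  have ne : [set D x | x in conv3 u v w] (D u) by exists u => //; exact: conv3_1.
  rewrite ge_sup//; last by exists (D u).
  have /andP[Du _] := hD u (conv3_1 u v w).
  by rewrite andbT (le_trans Du)// ub_le_sup//; exists e.
move=> hp hq hr; have /andP[h1 h2] := half _ _ _ _ _ _ hp hq hr.
have /andP[_ h3] : 0 <= sup [set dist_to (conv3 p q r) x | x in conv3 p' q' r'] <= e.
  by apply: half; rewrite sqdC.
by rewrite /hausdorff le_max h1 /= ge_max h2.
Qed.

(** The factor that gives the triangle with vertices [(0,0)], [(1,0)], [(t,1)] diameter 1 when
    [0 <= t <= 1/2]. *)
Definition unit_scale {R : realType} (t : R) : R := (Num.sqrt (1 + (1 - t) ^+ 2))^-1.

Lemma sqr_unit_scale {R : realType} (t : R) :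
  unit_scale t ^+ 2 = (1 + (1 - t) ^+ 2)^-1.
Proof. by rewrite /unit_scale exprVn sqr_sqrtr ?ltW ?sqr1_gt0. Qed.

Lemma normalize_T0 {R : realType} : let l := unit_scale (x0 R) in
  normalize (T0 R) = conv3 (l *: pt 0 0) (l *: pt 1 0) (l *: pt (x0 R) 1).
Proof.
move=> l; have hT : shape (T0 R) (1 * (1 + (1 - x0 R) ^+ 2)) 1 (1 * (1 + x0 R ^+ 2)).
  apply: sides_unit_shape => //; first exact: x0_itv.
  by rewrite !mul1r; exact: sides_T0.
have dT : (diam (T0 R))^-1 = l by rewrite (diamE _ _ _ _ hT) mul1r.
rewrite /normalize dT /T0; apply: conv3_image => a b c _.
by apply: row2P; rewrite !coordE; ring.
Qed.

Lemma normalize_raff_sides {R : realType} (A : set 'rV[R]_2) (Q : rectangle R)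
    (a b c : R) :
  shape A a b c -> extremal A Q ->
  let t := (a + b - c) / (2 * a) in let k := unit_scale t ^+ 2 in
  sides (normalize (raff Q @` A)) k (k * (1 + t ^+ 2)) (k * (1 + (1 - t) ^+ 2)).
Proof.
move=> hA hQ t k; have [k' k'0 hs] := extremal_sides _ _ _ _ _ hA hQ.
have t01 := shape_tau_itv _ _ _ _ hA; rewrite -/t in hs t01.
have [hn _ _ _] := normalize_shape _ _ _ _ (sides_unit_shape _ _ _ k'0 t01 hs).
have := sides_swap12 _ _ _ _ (sides_swap23 _ _ _ _ hn).
have s0 : 1 + (1 - t) ^+ 2 != 0 by rewrite lt0r_neq0// sqr1_gt0.
have k0 : k' != 0 by rewrite lt0r_neq0.
congr sides; rewrite /k sqr_unit_scale; field; rewrite ?s0 ?k0//.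
Qed.

Lemma unit_scale_shape {R : realType} (A : set 'rV[R]_2) (t : R) :
  let k := unit_scale t ^+ 2 in 0 <= t <= 1 / 2 ->
  sides A k (k * (1 + t ^+ 2)) (k * (1 + (1 - t) ^+ 2)) ->
  shape A (k * (1 + (1 - t) ^+ 2)) k (k * (1 + t ^+ 2)).
Proof.
by move=> k; apply: sides_unit_shape; rewrite /k sqr_unit_scale invr_gt0 sqr1_gt0.
Qed.

(** The congruence puts the base on the first axis with an end at the origin, as for [T0]. The other
    two vertices then differ from their counterparts by [(u, 0)] and [(v, u)], of length at most the
    sum of the absolute values. *)
Lemma unit_scale_hausdorff {R : realType} (A : set 'rV[R]_2) (t : R) :
  let k := unit_scale t ^+ 2 in
  sides A k (k * (1 + t ^+ 2)) (k * (1 + (1 - t) ^+ 2)) ->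
  exists2 f, congruence f & 0 <= hausdorff (f @` A) (normalize (T0 R)) <=
    `|unit_scale t - unit_scale (x0 R)|
    + `|unit_scale t * t - unit_scale (x0 R) * x0 R|.
Proof.
move=> k hA; have k0 : 0 < k by rewrite /k sqr_unit_scale invr_gt0 sqr1_gt0.
have [f hf fA] : exists2 f, (forall x y, sqd (f x) (f y) = 1 * sqd x y) & f @` A =
    conv3 (unit_scale t *: pt 0 0) (unit_scale t *: pt 1 0) (unit_scale t *: pt t 1).
  apply: sides_scaling hA _ _; last by rewrite !mul1r; exact: sides_unit_triangle.
  by rewrite -[X in gram X](mulr1 k) gramZ gram_unit mulr_gt0// exprn_gt0.
exists f; first by apply/congruenceP => x y; rewrite hf mul1r.
rewrite fA normalize_T0; set l := unit_scale t; set l0 := unit_scale _.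
set u := l - l0; set v := l * t - l0 * x0 R.
have uv : 0 <= `|u| * `|v| by rewrite mulr_ge0.
have e2 : (`|u| + `|v|) ^+ 2 = u ^+ 2 + v ^+ 2 + 2 * (`|u| * `|v|).
  by rewrite sqrrD !real_normK ?num_real//; ring.
apply: hausdorff_itv; rewrite ?addr_ge0// e2 sqdE !coordE.
- by have := sqr_ge0 u; have := sqr_ge0 v; lra.
- by rewrite -/u; have := sqr_ge0 v; rewrite /u; lra.
- by rewrite /u /v; lra.
Qed.

Lemma unit_scale_cvg {R : realType} (t : nat -> R) (y : R) :
  t n @[n --> \oo] --> y ->
  `|unit_scale (t n) - unit_scale y| + `|unit_scale (t n) * t n - unit_scale y * y|
    @[n --> \oo] --> (0 : R).
Proof.
move=> ht.
have hl : unit_scale (t n) @[n --> \oo] --> unit_scale y.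
  apply: cvgV; first by rewrite lt0r_neq0// sqrtr_gt0 sqr1_gt0.
  apply: continuous_cvg; first exact: sqrt_continuous.
  apply: cvgD; first exact: cvg_cst.
  by apply: cvgM; apply: cvgB => //; exact: cvg_cst.
have -> : 0 = `|unit_scale y - unit_scale y| + `|unit_scale y * y - unit_scale y * y| :> R.
  by rewrite !subrr normr0 addr0.
apply: cvgD; apply: cvg_norm; apply: cvgB; try exact: cvg_cst; first exact: hl.
exact: cvgM.
Qed.

(** * Iterates of the parameter map *)

Lemma iter_step_itv {R : realType} (t : R) n :
  0 <= t <= 1 / 2 -> 0 <= iter n step t <= 1 / 2.
Proof. by move=> ht; elim: n => //= n; exact: step_itv. Qed.

Lemma iter_step_contract {R : realType} (t : R) n : 0 <= t <= 1 / 2 ->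
  `|iter n.+1 step t - x0 R| <= 2^-1 * `|iter n step t - x0 R|.
Proof.
move=> ht; rewrite iterS -[X in _ - X](step_fixP _).2//.
by apply: step_contract; [exact: iter_step_itv|exact: x0_itv].
Qed.

Lemma iter_step_cvg {R : realType} (t : R) : 0 <= t <= 1 / 2 ->
  iter n step t @[n --> \oo] --> x0 R.
Proof.
move=> ht; apply/subr_cvg0/norm_cvg0P.
have le n : `|iter n step t - x0 R| <= geometric `|t - x0 R| 2^-1 n.
  elim: n => [|n ih]; first by rewrite /geometric /= expr0 mulr1.
  apply: le_trans (iter_step_contract _ _ ht) _.
  by rewrite /geometric /= exprS mulrCA ler_pM2l.
apply: (squeeze_cvgr _ (cvg_cst 0) (cvg_geometric `|t - x0 R| _)).
  by apply: nearW => n; apply/andP; split; [exact: normr_ge0|exact: le].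
by rewrite ger0_norm; lra.
Qed.

(** An orbit that reaches the fixed point starts there, by injectivity of [step]. *)
Lemma iter_step_neq {R : realType} (t : R) n : 0 <= t <= 1 / 2 -> t <> x0 R ->
  iter n step t <> x0 R.
Proof.
move=> ht tx; elim: n => //= n ih; rewrite -[RHS](step_fixP _).2//.
by move/(step_inj _ _ (iter_step_itv _ n ht) x0_itv).
Qed.

(** The distance to the fixed point never vanishes and at least halves at each step, so no value
    recurs. *)
Lemma iter_step_inj {R : realType} (t : R) : 0 <= t <= 1 / 2 -> t <> x0 R ->
  injective (fun n => iter n step t).
Proof.
move=> ht tx; have dec n : `|iter n.+1 step t - x0 R| < `|iter n step t - x0 R|.
  apply: le_lt_trans (iter_step_contract _ _ ht) _.
  rewrite gtr_pMl; first by lra.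
  by rewrite normr_gt0 subr_eq0; apply/eqP; exact: iter_step_neq.
have lt m n : (m < n)%N -> `|iter n step t - x0 R| < `|iter m step t - x0 R|.
  elim: n => // n ih; rewrite ltnS leq_eqVlt => /predU1P[->//|/ih].
  exact: lt_trans.
by move=> m n /= e; case: (ltngtP m n) => // /lt; rewrite e ltxx.
Qed.

(** * Invariance of triangles and the sequence of images *)

Lemma triangle_shape {R : realType} (T : set 'rV[R]_2) :
  triangle T -> exists a b c, shape T a b c.
Proof.
move=> [p [q [r [hf ->]]]].
apply: (sides_shape _ (sqd p q) (sqd p r) (sqd q r)); first by exists p, q, r.
rewrite gram_gt0P; apply/negP => /eqP; rewrite /cross => D0.
have free s t : s *: (q - p) + t *: (r - p) = 0 -> s = 0 /\ t = 0.
  move=> h; have /(row_free_inj hf) : row_mx s%:M t%:M *m col_mx (q - p) (r - p)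
      = 0 *m col_mx (q - p) (r - p) by rewrite mul_row_col !mul_scalar_mx mul0mx.
  rewrite -row_mx0 => /eq_row_mx[/matrixP /(_ 0 0) hs /matrixP /(_ 0 0) ht].
  by move: hs ht; rewrite !mxE !mulr1n.
(* When [cross] vanishes, the coordinates of the edge vectors are themselves coefficients of linear
   relations between these vectors. So both edges are zero, and then the coefficients [1] and [0]
   contradict independence. *)
have [r0 q0] : r 0 0 - p 0 0 = 0 /\ - (q 0 0 - p 0 0) = 0.
  by apply: free; apply: row2P; rewrite !coordE mxE; lra.
have [r1 q1] : r 0 1 - p 0 1 = 0 /\ - (q 0 1 - p 0 1) = 0.
  by apply: free; apply: row2P; rewrite !coordE mxE; lra.
have [/eqP] : (1 : R) = 0 /\ (0 : R) = 0.
  by apply: free; apply: row2P; rewrite !coordE mxE; lra.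
by rewrite oner_eq0.
Qed.

Lemma similar_T0_sides {R : realType} (T : set 'rV[R]_2) (a b c : R) :
  shape T a b c -> similar_sets T (T0 R) ->
  exists k, [/\ 0 < k, a = k * (1 + (1 - x0 R) ^+ 2), b = k & c = k * (1 + x0 R ^+ 2)].
Proof.
move=> hT hs; have [hTs _ _ _] := hT.
have [k k0 h] := similar_sides _ _ _ _ _ hs hTs.
have h0 : shape (T0 R) (1 * (1 + (1 - x0 R) ^+ 2)) 1 (1 * (1 + x0 R ^+ 2)).
  by apply: sides_unit_shape x0_itv _ => //; rewrite !mul1r; exact: sides_T0.
have [ha hb hc] := shape_inj _ _ _ _ _ _ _ (shape_scale _ _ _ _ _ _ k0 hT h) h0.
have kn := lt0r_neq0 k0; rewrite !mul1r in ha hc.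
exists k^-1; rewrite invr_gt0 k0 -ha -hc !mulKf//; split=> //.
by apply: (mulfI kn); rewrite hb divff.
Qed.

(** The image has parameter [step t], and similarity preserves the parameter, so [t] is the fixed
    point. *)
Lemma weakly_invariant_similar_T0 {R : realType} (T : set 'rV[R]_2) :
  triangle T -> weakly_invariant_body T -> similar_sets T (T0 R).
Proof.
move=> /triangle_shape[a [b [c hT]]] [Q hQ hs].
have t01 := shape_tau_itv _ _ _ _ hT.
have [k k0 hr] := extremal_sides _ _ _ _ _ hT hQ.
set t := (a + b - c) / (2 * a) in t01 hr.
have [k' k'0] := similar_sides _ _ _ _ _ hs hr; rewrite !mulrA => h.
have kk : 0 < k' * k by rewrite mulr_gt0.
have [ha hb hc] := shape_inj _ _ _ _ _ _ _ hT (sides_unit_shape _ _ _ kk t01 h).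
have /step_fixP tx : step t = t by rewrite -(tau_step _ _ (lt0r_neq0 kk)) -ha -hc -hb.
by apply: sides_similar_T0 kk _; rewrite -tx.
Qed.

Lemma similar_T0_invariant {R : realType} (T : set 'rV[R]_2) :
  triangle T -> similar_sets T (T0 R) -> invariant_body T.
Proof.
move=> /triangle_shape[a [b [c hT]]] hs Q hQ.
have [k [k0 ha hb hc]] := similar_T0_sides _ _ _ _ hT hs.
have [k' k'0 hr] := extremal_sides _ _ _ _ _ hT hQ.
have tx : (a + b - c) / (2 * a) = x0 R.
  by rewrite ha hb hc tau_step ?lt0r_neq0//; exact/step_fixP.
rewrite tx in hr; have [hTs _ _ _] := hT.
have k'n := lt0r_neq0 k'0.
apply: (sides_similar _ _ (k / k') _ _ _ _ hr); first by rewrite divr_gt0.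
- by rewrite -[X in gram X](mulr1 k') gramZ gram_unit mulr_gt0// exprn_gt0.
- rewrite !mulrA !divfK// -ha -hc -hb.
  exact/sides_swap12/sides_swap23.
Qed.

Lemma triangle_not_strongly_invariant {R : realType} (T : set 'rV[R]_2) :
  triangle T -> ~ strongly_invariant_body T.
Proof.
move=> /triangle_shape[a [b [c /extremal_exists[Q [hQ _ hne]]]]] h.
exact: hne (h Q hQ).
Qed.

Lemma triangle_extremal_exists {R : realType} (T : set 'rV[R]_2) :
  triangle T -> exists Q, extremal T Q.
Proof.
move=> /triangle_shape[a [b [c hT]]].
have [Q [hQ hr _]] := extremal_exists _ _ _ _ hT.
by exists Q; apply/(extremalP _ _ _ _ _ hT).
Qed.

Theorem theorem2 (R : realType) (T : set 'rV[R]_2) (hT : triangle T) :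
  ((weakly_invariant_body T <-> similar_sets T (T0 R)) /\
   (similar_sets T (T0 R) -> invariant_body T /\ ~ strongly_invariant_body T)) /\
  ((forall Q : rectangle R, extremal T Q -> ~ similar_sets (raff Q @` T) (T0 R)) ->
   forall T_ : nat -> set 'rV[R]_2,
     (forall k : nat, (1 <= k)%N -> triangle (T_ k)) ->
     T_ 1%N = T ->
     (forall k : nat, (1 <= k)%N ->
        exists2 Q : rectangle R, extremal (T_ k) Q &
          T_ k.+1 = normalize (raff Q @` T_ k)) ->
     (forall j k : nat, (1 <= j)%N -> (1 <= k)%N -> j <> k ->
        ~ congruent_sets (T_ j) (T_ k)) /\
     converges_upto_congruence T_ (normalize (T0 R))).
Proof.
split.
  split.
    split=> [|hs]; first exact: weakly_invariant_similar_T0.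
    by have [Q hQ] := triangle_extremal_exists _ hT; exists Q => //;
      exact: similar_T0_invariant hQ.
  move=> hs; split; first exact: similar_T0_invariant.
  exact: triangle_not_strongly_invariant.
move=> hnot T_ _ T1 hstep.
have [a [b [c hTs]]] := triangle_shape _ hT.
set t := (a + b - c) / (2 * a); have t01 : 0 <= t <= 1 / 2 := shape_tau_itv _ _ _ _ hTs.
(* If [t] were [x0 R], the image under the first affinity would be similar to [T0], against
   [hnot]. *)
have tx : t <> x0 R.
  move=> tx; have [Q hQ _] := hstep 1%N isT; rewrite T1 in hQ.
  have [k k0 hr] := extremal_sides _ _ _ _ _ hTs hQ.
  rewrite -/t tx in hr.
  exact: hnot hQ (sides_similar_T0 _ _ k0 hr).
(* Indices start at 1: the foot fraction [iter n step t] of [T_ n.+1] determines [T_ n.+2] up to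
   congruence. *)
have next n a' b' c' : shape (T_ n.+1) a' b' c' -> (a' + b' - c') / (2 * a') = iter n step t ->
    let s := iter n step t in let k := unit_scale s ^+ 2 in
    sides (T_ n.+2) k (k * (1 + s ^+ 2)) (k * (1 + (1 - s) ^+ 2)).
  move=> hn hs s k; have [Q hQ ->] := hstep n.+1 isT.
  by have := normalize_raff_sides _ _ _ _ _ hn hQ; rewrite hs.
have inv n : exists a' b' c', shape (T_ n.+1) a' b' c' /\
    (a' + b' - c') / (2 * a') = iter n step t.
  elim: n => [|n [a' [b' [c' [hn hs]]]]]; first by exists a, b, c; rewrite T1.
  have := unit_scale_shape _ _ (iter_step_itv _ n t01) (next _ _ _ _ hn hs).
  move=> h; do 3 eexists; split; first exact: h.
  by rewrite tau_step// sqr_unit_scale invr_eq0 lt0r_neq0 ?sqr1_gt0.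
split.
  move=> [//|j] [//|k] _ _ jk hc; apply: jk; congr _.+1.
  have [a1 [b1 [c1 [h1 e1]]]] := inv j; have [a2 [b2 [c2 [h2 e2]]]] := inv k.
  have [hs1 g1 bc1 ca1] := h1.
  have h1' : shape (T_ k.+1) a1 b1 c1 by split=> //; exact: congruent_sides hc hs1.
  have [ea eb ec] := shape_inj _ _ _ _ _ _ _ h1' h2.
  by apply: (iter_step_inj _ t01 tx); rewrite -e1 -e2 ea eb ec.
have hphi n : exists f, congruence f /\ 0 <= hausdorff (f @` T_ n.+2) (normalize (T0 R)) <=
    `|unit_scale (iter n step t) - unit_scale (x0 R)|
    + `|unit_scale (iter n step t) * iter n step t - unit_scale (x0 R) * x0 R|.
  have [a' [b' [c' [hn hs]]]] := inv n.
  by have [f ? ?] := unit_scale_hausdorff _ _ (next _ _ _ _ hn hs); exists f.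
have [phi hphi'] := choice hphi.
(* [phi n] places [T_ n.+2], the terms from the second on being normalized images. The truncated
   predecessor supplies some congruence at indices 0 and 1, which do not affect the limit. *)
exists (fun k => phi k.-2); first by move=> k; exact: (hphi' _).1.
rewrite -(cvg_shiftn 2).
apply: (squeeze_cvgr _ (cvg_cst 0) (unit_scale_cvg _ _ (iter_step_cvg _ t01))).
by apply: nearW => n; rewrite /= addn2; exact: (hphi' n).2.
Qed.
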